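(* Let $M$ be a manifold modeled on a Banach space $\mathbb{E}$ and let $L:\mathbb{R}\times TM\to\mathbb{R}$ be a regular time dependent Lagrangian. Then $L$ induces a vector bundle structure on $\pi^2_L:\mathbb{R}\times T^2M\to\mathbb{R}\times M$ such that the integral curves of the zero section of $\pi^2_L$ are solutions of the Euler–Lagrange equation $$\frac{d}{ds}\big\{\partial_3L\big(s,c(s),c'(s)\big)[c'(s)]\big\}=\partial_2L\big(s,c(s),c'(s)\big)[c'(s)].$$
   Context: All manifolds and maps are smooth; $M$ is modeled on a (possibly infinite dimensional) real Banach space $\mathbb{E}$. In a chart $(U_\alpha,\phi_\alpha)$ of $M$ ($U_\alpha$ identified with its image in $\mathbb{E}$), points of $\mathbb{R}\times TM$ are written $(t,x,y)\in\mathbb{R}\times U_\alpha\times\mathbb{E}$, tangent vectors to $\mathbb{R}\times TM$ are written $(t,x,y;s,z,w)$, and $\partial_i$ is the partial derivative in the $i$-th variable. The Euler–Lagrange equation is understood in such local coordinates. A time dependent Lagrangian is a smooth map $L:\mathbb{R}\times TM\to\mathbb{R}$; it is regular if at every point the bilinear form $\partial_3^2L(t,x,y)$ on $\mathbb{E}$ is strongly nondegenerate, i.e. induces an isomorphism $\mathbb{E}\to\mathbb{E}^*$. A time dependent semispray is a vector field on $\mathbb{R}\times TM$ locally of the form $(t,x,y;1,y,-G_\alpha(t,x,y))$; the $G_\alpha$ are its local components. The Lagrangian semispray $Z$ of $L$ is the unique semispray with $i_Z dt=1$, $i_Z\Omega_L=0$, where $\Omega_L=\omega_L+dE_L\wedge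 dt$, $\omega_L=-d\theta_L$, locally $\theta_L(t,x,y)(s,z,w)=\partial_3L(t,x,y)z$ and $E_L(t,x,y)=\partial_3L(t,x,y)y-L(t,x,y)$. Second order tangent bundle: two smooth curves with the same value $x$ at $0$ are 2-equivalent if, in a chart, their first and second derivatives at $0$ agree; $[\gamma,x]_2$ is the class of $\gamma$, $T^2M$ the set of all classes, and the projection $\mathbb{R}\times T^2M\to\mathbb{R}\times M$ is $(t,[\gamma,x]_2)\mapsto(t,x)$. The vector bundle structure meant is the one induced by the semispray $Z$; a semispray with local components $G_\alpha$ induces the structure given by the trivializations $$\Phi^2_\alpha(t,[\gamma,x]_2)=\big(t,\gamma_\alpha(0),\gamma_\alpha'(0),\gamma_\alpha''(0)+G_\alpha(t,\gamma_\alpha(0),\gamma_\alpha'(0))\big)\in\mathbb{R}\times U_\alpha\times\mathbb{E}\times\mathbb{E},\quad\gamma_\alpha=\phi_\alpha\circ\gamma.$$ With respect to it, a curve $c$ in $M$ is an integral curve of the zero section if and only if in every chart $(\phi_\alpha\circ c)''(t)+G_\alpha\big(t,(\phi_\alpha\circ c)(t),(\phi_\alpha\circ c)'(t)\big)=0$.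
   Formalization: The displayed equation is false if c'(s) inside the braces is differentiated too (L = y²/2 − x²/2, c'' = −c); it is proved as the E*-valued equation d/ds ∂₃L(s,c,c') = ∂₂L(s,c,c'), and evaluated at c'(s) with that vector held fixed. *)

(* Defs.v *)
From HB Require Import structures.
From mathcomp Require Import all_boot all_order all_algebra.
From mathcomp Require Import mathcomp_extra boolp classical_sets functions.
From mathcomp Require Import reals topology normedtype derive.

Set Implicit Arguments.
Unset Strict Implicit.
Unset Printing Implicit Defensive.
Import Order.TTheory GRing.Theory Num.Theory.
Import numFieldNormedType.Exports.
Local Open Scope classical_set_scope.
Local Open Scope ring_scope.

(** * The Banach space L(E, F) of continuous linear maps *)

Section clin.
Context {R : realType} (E F : normedModType R).

Definition is_clin : {pred E -> F} :=
  [pred f | `[< linear f /\ continuous f >]].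

Lemma is_clinP (f : E -> F) : (f \in is_clin) <-> linear f /\ continuous f.
Proof. by split=> [/asboolP//|fP]; apply/asboolP. Qed.

Lemma is_clin_submod_closed : submod_closed is_clin.
Proof.
split=> [|a f g].
  apply/is_clinP; split=> [b x y|x]; last exact: cst_continuous.
  by rewrite scaler0 addr0.
move=> /is_clinP[lf cf] /is_clinP[lg cg]; apply/is_clinP; split=> [b x y|x].
  rewrite !fctE (lf b x y) (lg b x y) !scalerDr !scalerA (mulrC a b).
  by rewrite addrACA.
by apply: cvgD; [apply: cvgZr; exact: cf|exact: cg].
Qed.

HB.instance Definition _ :=
  GRing.isSubmodClosed.Build R (E -> F) is_clin is_clin_submod_closed.

Record clin : Type := Clin { clin_fun :> E -> F; _ : clin_fun \in is_clin }.

HB.instance Definition _ := [isSub for clin_fun].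
HB.instance Definition _ := [Choice of clin by <:].
HB.instance Definition _ := [SubChoice_isSubLmodule of clin by <:].

Lemma clin_linear (f : clin) : linear f.
Proof. by case: f => f /= /is_clinP[]. Qed.

HB.instance Definition _ (f : clin) :=
  GRing.isLinear.Build R E F *:%R (clin_fun f) (@clin_linear f).

Lemma clin_continuous (f : clin) : continuous f.
Proof. by case: f => f /= /is_clinP[]. Qed.

Definition opnorm (f : clin) : R := sup [set `|f x| | x in [set x | `|x| <= 1]].

Lemma opnorm_has_sup (f : clin) :
  has_sup [set `|f x| | x in [set x : E | `|x| <= 1]].
Proof.
split; first by exists `|f 0|, 0 => //=; rewrite normr0.
have /linear_boundedP := continuous_linear_bounded 0 (@clin_continuous f 0).
move=> /pinfty_ex_gt0[r r0 fr]; exists r => _ [x /= x1 <-].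
by rewrite (le_trans (fr x))// ler_piMr// ltW.
Qed.

Lemma opnorm_ub (f : clin) x : `|x| <= 1 -> `|f x| <= opnorm f.
Proof. by move=> x1; apply: ub_le_sup; [case: (opnorm_has_sup f)|exists x]. Qed.

Lemma opnorm_le (f : clin) (M : R) :
  (forall x, `|x| <= 1 -> `|f x| <= M) -> opnorm f <= M.
Proof.
move=> fM; apply: ge_sup; first by case: (opnorm_has_sup f).
by move=> _ [x /= x1 <-]; exact: fM.
Qed.

Lemma opnormD (f g : clin) : opnorm (f + g) <= opnorm f + opnorm g.
Proof.
apply: opnorm_le => x x1.
by rewrite (le_trans (ler_normD _ _))// lerD// opnorm_ub.
Qed.

Lemma opnormZ (a : R) (f : clin) : opnorm (a *: f) = `|a| * opnorm f.
Proof.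
have le b g : opnorm (b *: g) <= `|b| * opnorm g.
  by apply: opnorm_le => x x1; rewrite normrZ ler_wpM2l// opnorm_ub.
apply/eqP; rewrite eq_le le /=; have [->|a0] := eqVneq a 0.
  rewrite normr0 mul0r (le_trans _ (@opnorm_ub _ 0 _))// normr0//.
by rewrite -ler_pdivlMl ?normr_gt0// -normfV -{1}(scalerK a0 f) le.
Qed.

Lemma opnorm0_eq0 (f : clin) : opnorm f = 0 -> f = 0.
Proof.
move=> f0; apply: val_inj; apply/funext => x /=.
have [->|x0] := eqVneq x 0; first by rewrite linear0.
have nx0 : `|x|^-1 != 0 by rewrite invr_eq0 normr_eq0.
have : `|f (`|x|^-1 *: x)| <= 0.
  by rewrite -f0 opnorm_ub// normrZ normfV normr_id mulVf// normr_eq0.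
by rewrite normr_le0 linearZ /= scaler_eq0 (negbTE nx0) => /eqP.
Qed.

HB.instance Definition _ :=
  Lmodule_isNormed.Build R clin opnormD opnormZ opnorm0_eq0.

End clin.

Notation "''L' ( E , F )" := (clin E F)
  (at level 8, format "''L' ( E ,  F )") : type_scope.

Definition toplinear_iso {R : realType} {E F : normedModType R} (A : 'L(E, F)) :=
  exists B : 'L(F, E), (forall x, B (A x) = x) /\ (forall y, A (B y) = y).

(** * Smooth maps between normed spaces *)

Section smooth.
Context {R : realType}.

(* The Frechet differential as an element of L(E, F); a default value where f
   is not differentiable *)
Definition Diff {E F : normedModType R} (f : E -> F) (x : E) : 'L(E, F) :=
  insubd (0 : 'L(E, F)) ('d f x : E -> F).

Fixpoint Cn (n : nat) {E F : normedModType R} (U : set E) (f : E -> F) : Prop :=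
  match n with
  | 0 => forall x, U x -> {for x, continuous f}
  | n'.+1 => (forall x, U x -> differentiable f x) /\ Cn n' U (Diff f)
  end.

Definition smooth_on {E F : normedModType R} (U : set E) (f : E -> F) : Prop :=
  open U /\ forall n, Cn n U f.

End smooth.

(** * Manifolds modeled on a normed space, given by an atlas *)

Record atlas {R : realType} (E : normedModType R) := Atlas {
  points :> Type ;
  atlas_index : Type ;
  dom : atlas_index -> set points ;
  chart : atlas_index -> points -> E }.
Arguments dom {R E a}.
Arguments chart {R E a}.

Section manifold.
Context {R : realType} {E : normedModType R} (A : atlas E).

Definition img (i : atlas_index A) : set E := chart i @` dom i.

(* The expression f \o (chart i)^-1 of f in the chart i; only its values on
   img i are meaningful *)
Definition local_expr {W : pointedType} (i : atlas_index A) (f : A -> W)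
    (x : E) : W :=
  get [set w | exists2 m, dom i m /\ chart i m = x & w = f m].

(* The underlying set carries no prior topology: the charts induce it. No
   separation axiom is assumed. *)
Definition is_manifold : Prop :=
  [/\ forall m : A, exists i : atlas_index A, dom i m,
      forall (i : atlas_index A) m m', dom i m -> dom i m' ->
        chart i m = chart i m' -> m = m'
    & forall i j : atlas_index A,
        smooth_on (chart i @` (dom i `&` dom j)) (local_expr i (chart j))].

Definition smooth_fun {W : normedModType R} (f : A -> W) : Prop :=
  forall i : atlas_index A, smooth_on (img i) (local_expr i f).

(* The values of a curve away from t are irrelevant: gamma stands for its germ
   at t *)
Definition smooth_curve_at (gamma : R -> A) (t : R) : Prop :=
  exists (i : atlas_index A) (U : set R^o),
    [/\ U t, forall s, U s -> dom i (gamma s)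
      & smooth_on U (fun s : R^o => chart i (gamma s))].

Definition jet_equiv (k : nat) (gamma delta : R -> A) : Prop :=
  gamma 0 = delta 0 /\
  exists2 i : atlas_index A, dom i (gamma 0) &
    forall n : nat, (0 < n <= k)%N ->
      (fun s : R => chart i (gamma s))^`(n)%classic 0 =
      (fun s : R => chart i (delta s))^`(n)%classic 0.

(* The set of all classes [gamma, x]_k *)
Definition jet (k : nat) : Type :=
  {q : set (R -> A) | exists2 gamma, smooth_curve_at gamma 0 &
    q = [set delta | smooth_curve_at delta 0 /\ jet_equiv k gamma delta]}.

Definition jet_rep k (q : jet k) : R -> A := projT1 (cid2 (proj2_sig q)).

Definition jet_base k (q : jet k) : A := jet_rep q 0.

End manifold.
Arguments jet_rep {R E A k}.
Arguments jet_base {R E A k}.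

Definition tangent {R : realType} {E : normedModType R} (A : atlas E) :
    atlas (E * E)%type :=
  {| points := jet A 1 ;
     atlas_index := atlas_index A ;
     dom := fun i q => dom i (jet_base q) ;
     chart := fun i q => (chart i (jet_base q),
                          (fun s : R => chart i (jet_rep q s))^`()%classic 0) |}.

(* The product R x A *)
Definition time {R : realType} {E : normedModType R} (A : atlas E) :
    atlas (R^o * E)%type :=
  {| points := (R * A)%type ;
     atlas_index := atlas_index A ;
     dom := fun i p => dom i p.2 ;
     chart := fun i p => (p.1, chart i p.2) |}.

Section vector_field.
Context {R : realType} {E : normedModType R} (A : atlas E).

(* The principal part of X in the chart i *)
Definition principal_part (X : A -> tangent A) (i : atlas_index A) : E -> E :=
  local_expr i (fun m => (@chart _ _ (tangent A) i (X m)).2).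

Definition vector_field (X : A -> tangent A) : Prop :=
  (forall m, jet_base (X m) = m) /\
  forall i : atlas_index A, smooth_on (img i) (principal_part X i).

End vector_field.

(** * Vector bundles *)

(* pi : P -> B with typical fibre F; the trivialization over dom i is
   p |-> (pi p, (Phi i p).2), and (Phi i p).1 is pi p read in the chart i *)
Definition vector_bundle {R : realType} {E F : normedModType R} (B : atlas E)
    (P : Type) (pi : P -> B) (Phi : atlas_index B -> P -> (E * F)%type) : Prop :=
  [/\ forall i p, dom i (pi p) -> (Phi i p).1 = chart i (pi p),
      forall i b (v : F), dom i b ->
        exists! p, pi p = b /\ Phi i p = (chart i b, v)
    & forall i j : atlas_index B, exists g : E -> 'L(F, F),
        [/\ smooth_on (chart i @` (dom i `&` dom j)) g,
            forall b, dom i b -> dom j b -> toplinear_iso (g (chart i b))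
          & forall p, dom i (pi p) -> dom j (pi p) ->
              (Phi j p).2 = g (chart i (pi p)) (Phi i p).2]].

(** * Differential forms on a normed space *)

Section forms.
Context {R : realType} {V : normedModType R}.

Definition ext_deriv (theta : V -> V -> R^o) (p u v : V) : R :=
  'd (fun q => theta q v) p u - 'd (fun q => theta q u) p v.

Definition wedge (a b : V -> V -> R^o) (p u v : V) : R :=
  a p u * b p v - a p v * b p u.

End forms.

(** * Time dependent Lagrangians *)

(* A point (t, x, y) of R x U x E is the triple (t, (x, y)), and a tangent
   vector (s, z, w) at this point is (s, (z, w)) *)
Section local_lagrangian.
Context {R : realType} {E : normedModType R}.
Let V : normedModType R := (R^o * (E * E))%type.

Definition D2 {F : normedModType R} (f : V -> F) (p : V) : 'L(E, F) :=
  Diff (fun x => f (p.1, (x, p.2.2))) p.2.1.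

Definition D3 {F : normedModType R} (f : V -> F) (p : V) : 'L(E, F) :=
  Diff (fun y => f (p.1, (p.2.1, y))) p.2.2.

Variable l : V -> R^o.

Definition theta_form (p u : V) : R^o := D3 l p u.2.1.

Definition energy (p : V) : R^o := D3 l p p.2.2 - l p.

Definition dt_form (p u : V) : R^o := u.1.

Definition omega_form (p u v : V) : R := - ext_deriv theta_form p u v.

Definition Omega_form (p u v : V) : R :=
  omega_form p u v + wedge (fun q => 'd energy q) dt_form p u v.

End local_lagrangian.

Section lagrangian.
Context {R : realType} {E : normedModType R} (M : atlas E).

Local Notation RTM := (time (tangent M)).

(* D3 (D3 l) p : 'L(E, 'L(E, R^o)) is the map E -> E^* induced by the bilinear
   form *)
Definition regular (L : RTM -> R^o) : Prop :=
  forall (i : atlas_index RTM) p, img i p ->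
    toplinear_iso (D3 (D3 (local_expr i L)) p).

Definition semispray (Z : RTM -> tangent RTM) : Prop :=
  vector_field Z /\
  forall (i : atlas_index RTM) p, img i p ->
    (principal_part Z i p).1 = 1 /\ (principal_part Z i p).2.1 = p.2.2.

(* Z is (t, x, y; 1, y, - G_i (t, x, y)) in the chart i *)
Definition spray_comp (Z : RTM -> tangent RTM) (i : atlas_index RTM)
    (p : R^o * (E * E)) : E := - (principal_part Z i p).2.2.

Definition lagrangian_semispray (L : RTM -> R^o) (Z : RTM -> tangent RTM) :=
  semispray Z /\
  forall (i : atlas_index RTM) p, img i p ->
    dt_form p (principal_part Z i p) = 1 /\
    forall v, Omega_form (local_expr i L) p (principal_part Z i p) v = 0.

Definition pi2 (p : R * jet M 2) : time M := (p.1, jet_base p.2).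

(* The maps Phi^2_i of a semispray; their values outside of the preimage of
   dom i are irrelevant *)
Definition induced_trivializations (Z : RTM -> tangent RTM)
    (Phi : atlas_index M -> R * jet M 2 -> (R^o * E) * (E * E)) : Prop :=
  forall (i : atlas_index M) (t : R) (q : jet M 2) (gamma : R -> M),
    proj1_sig q gamma -> dom i (gamma 0) ->
    let x : R -> E := fun s => chart i (gamma s) in
    Phi i (t, q) =
      ((t, x 0),
       (x^`()%classic 0,
        x^`(2)%classic 0 + spray_comp Z i (t, (x 0, x^`()%classic 0)))).

Definition smooth_curve (J : set R^o) (c : R -> M) : Prop :=
  [/\ open J, is_interval J & forall t, J t -> smooth_curve_at c t].

(* In every trivialization the acceleration component of the 2-jet of c is the
   one of the zero section; the velocity component x'(t) is unconstrained *)
Definition zero_section_integral_curve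
    (Phi : atlas_index M -> R * jet M 2 -> (R^o * E) * (E * E))
    (J : set R^o) (c : R -> M) : Prop :=
  smooth_curve J c /\
  forall (t : R) (i : atlas_index M) (q : jet M 2),
    J t -> dom i (c t) -> proj1_sig q (fun s => c (t + s)) ->
    (Phi i (t, q)).2.2 = 0.

(* d/ds {D3 L (s, c, c')} = D2 L (s, c, c') as elements of E^*, and its
   evaluation at [c'(s)]. There the vector c'(s) is held fixed: differentiating
   it as well would add the term D3 L (s, c, c') [c''(s)] *)
Definition euler_lagrange (L : RTM -> R^o) (J : set R^o) (c : R -> M) : Prop :=
  forall (s : R) (i : atlas_index M), J s -> dom i (c s) ->
    let x : R -> E := fun r => chart i (c r) in
    let l := @local_expr _ _ RTM _ i L in
    is_derive s 1 (fun r : R^o => D3 l (r, (x r, x^`()%classic r)))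
      (D2 l (s, (x s, x^`()%classic s))) /\
    is_derive s 1
      (fun r : R^o => D3 l (r, (x r, x^`()%classic r)) (x^`()%classic s))
      (D2 l (s, (x s, x^`()%classic s)) (x^`()%classic s)).

End lagrangian.

(* Main.v *)
From HB Require Import structures.
Require Import Defs.
From mathcomp Require Import all_boot all_order all_algebra.
From mathcomp Require Import boolp classical_sets functions reals.
From mathcomp Require Import prodnormedzmodule topology normedtype landau derive.
From mathcomp Require Import ring.
Set Implicit Arguments.
Unset Strict Implicit.
Unset Printing Implicit Defensive.
Import Order.TTheory GRing.Theory Num.Theory numFieldNormedType.Exports.
Local Open Scope classical_set_scope.
Local Open Scope ring_scope.

(** In a chart, write l for L, p = (t, x, y), and consider a vector
    W = (1, y, a) at p. Expanding Omega_L(W, v) for v = (s, z, w), all terms in w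
    cancel and what remains is s * (delta y) - delta z, where
    delta = D(D3 l)(p) W - D2 l(p) is a continuous linear form on E
    ([Omega_formE]). Hence i_W Omega_L = 0 if and only if delta = 0, which is the
    Euler-Lagrange equation for a curve through x with velocity y and
    acceleration a at time t ([el_eq]). Its left-hand side is affine in a with
    linear part D3 (D3 l)(p), so that regularity provides exactly one solution a,
    the acceleration [el_acc]. It depends smoothly on p because inversion of
    continuous linear maps is smooth ([smooth_inverse]).

    To glue the local vectors (1, y, a) into a global semispray one needs that the
    Euler-Lagrange equation is invariant under a change of charts h
    ([el_eq_change]): l and l' being related by l(t, x, y) = l'(t, h x, Dh(x) y),
    second derivatives of h occur in both D(D3 l) W and D2 l, with their arguments
    exchanged, and they cancel by the symmetry of second derivatives
    ([second_derivative_sym]). The accelerations therefore transform by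
    a |-> D^2 h(x)(y, y) + Dh(x) a, which is also how the velocity of a curve in
    R x TM transforms, so that the vectors (1, y, a) define one section Z of the
    tangent bundle. Uniqueness of Z is uniqueness of a.

    The second derivative of a curve in M obeys the same transformation law. In
    c'' + G, where G = - a, the terms in D^2 h disappear and the trivializations of
    R x T^2M change by Dh x Dh, which is smooth and invertible: this is a vector
    bundle ([jet_vector_bundle]). A curve is an integral curve of the zero section
    when c'' + G = 0, that is when c'' is the acceleration a; then the derivative of
    D3 l(s, c, c'), which is D(D3 l)(1, c', c''), equals D2 l(s, c, c') by the
    equation defining a ([zero_section_euler_lagrange]).

    The calculus needed for this is developed for maps between normed spaces, with
    bounded bilinear maps in the curried form 'L(E, 'L(F, G)): the derivative of
    b (f x) (g x) is then a sum of two expressions of the same kind, which makes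
    the class C^n stable under products and composition by induction on n
    ([Cn_bil], [Cn_comp]). *)

(** * Continuous linear and bilinear maps *)

Section continuous_linear.
Context {R : realType}.
Implicit Types E F G H : normedModType R.

Lemma clin_norm_le E F (A : 'L(E, F)) x : `|A x| <= `|A| * `|x|.
Proof.
have [->|x0] := eqVneq x 0; first by rewrite linear0 !normr0 mulr0.
have nx0 : 0 < `|x| by rewrite normr_gt0.
rewrite -ler_pdivrMr// mulrC.
have -> : `|x|^-1 * `|A x| = `|A (`|x|^-1 *: x)|.
  by rewrite linearZ/= normrZ normfV normr_id.
by apply: opnorm_ub; rewrite normrZ normfV normr_id mulVf// gt_eqF.
Qed.

Lemma clin_norm_leP E F (A : 'L(E, F)) k :
  0 <= k -> (forall x, `|A x| <= k * `|x|) -> `|A| <= k.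
Proof.
move=> k0 Ak; apply: opnorm_le => x x1.
by rewrite (le_trans (Ak x))// -[leRHS]mulr1 ler_wpM2l.
Qed.

Lemma clinP E F (A B : 'L(E, F)) : (forall x, A x = B x) -> A = B.
Proof. by move=> AB; apply: val_inj; apply/funext. Qed.

(** Instances of the linearity lemmas whose right-hand sides are again
    applications of elements of 'L(E, F), so that rewriting can go on with the
    other rules about such applications. *)
Lemma clin0 E F (A : 'L(E, F)) : A 0 = 0.
Proof. exact: linear0. Qed.

Lemma clinD E F (A : 'L(E, F)) x y : A (x + y) = A x + A y.
Proof. exact: linearD. Qed.

Lemma clinB E F (A : 'L(E, F)) x y : A (x - y) = A x - A y.
Proof. exact: linearB. Qed.

Lemma clinZ E F (A : 'L(E, F)) a x : A (a *: x) = a *: A x.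
Proof. exact: linearZ. Qed.

Lemma clin_zeroE E F x : (0 : 'L(E, F)) x = 0.
Proof. by []. Qed.

Lemma clin_addE E F (A B : 'L(E, F)) x : (A + B) x = A x + B x.
Proof. by []. Qed.

Lemma clin_subE E F (A B : 'L(E, F)) x : (A - B) x = A x - B x.
Proof. by []. Qed.

Lemma bounded_is_clin E F (f : E -> F) : linear f ->
  (exists k, forall x, `|f x| <= k * `|x|) -> f \in @is_clin R E F.
Proof.
move=> lf [k fk]; apply/is_clinP; split=> //.
pose f' : {linear E -> F} := HB.pack f (GRing.isLinear.Build R E F *:%R f lf).
have : bounded_near f' (nbhs 0).
  apply/linear_boundedP; exists k; split=> [|r kr x]; first exact: num_real.
  by rewrite (le_trans (fk x))// ler_wpM2r// ltW.
by move=> /linear_bounded_continuous.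
Qed.

Definition mk_clin E F (f : E -> F) (lf : linear f)
    (bf : exists k, forall x, `|f x| <= k * `|x|) : 'L(E, F) :=
  Clin (bounded_is_clin lf bf).

(** Continuity of a bilinear map and of its curried form are expressed by one
    bound, and the curried form is an element of 'L(E, 'L(F, G)). *)
Section bilinear.
Context {E F G : normedModType R} (f : E -> F -> G).
Hypothesis lfr : forall x, linear (f x).
Hypothesis lfl : forall y, linear (f ^~ y).
Variable k : R.
Hypothesis k0 : 0 <= k.
Hypothesis fk : forall x y, `|f x y| <= k * `|x| * `|y|.

Let slice x : 'L(F, G) := mk_clin (lfr x) (ex_intro _ (k * `|x|) (fk x)).

Let slice_linear : linear slice.
Proof. by move=> a x x'; apply: clinP => y; exact: lfl. Qed.

Let slice_bounded x : `|slice x| <= k * `|x|.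
Proof. by apply: clin_norm_leP => [|y]; [exact: mulr_ge0|exact: fk]. Qed.

Definition mk_bil : 'L(E, 'L(F, G)) :=
  mk_clin slice_linear (ex_intro _ k slice_bounded).

End bilinear.

Program Definition idl E : 'L(E, E) := @mk_clin E E id _ _.
Next Obligation. by []. Qed.
Next Obligation. by move=> E; exists 1 => x; rewrite mul1r. Qed.

Definition flip E F G (b : 'L(E, 'L(F, G))) : 'L(F, 'L(E, G)).
Proof.
apply: (@mk_bil F E G (fun y x => b x y) _ _ `|b| (normr_ge0 b)).
- by move=> y a x x'; rewrite linearP.
- by move=> x a y y'; rewrite linearP.
- move=> y x; rewrite mulrAC (le_trans (clin_norm_le _ _))//.
  by rewrite ler_wpM2r// clin_norm_le.
Defined.

Definition compl E F G (g : 'L(F, G)) (f : 'L(E, F)) : 'L(E, G).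
Proof.
apply: (@mk_clin E G (fun x => g (f x))).
- by move=> a x y; rewrite !linearP.
- exists (`|g| * `|f|) => x; rewrite (le_trans (clin_norm_le _ _))//.
  by rewrite -mulrA ler_wpM2l// clin_norm_le.
Defined.

Lemma complE E F G (g : 'L(F, G)) (f : 'L(E, F)) x : compl g f x = g (f x).
Proof. by []. Qed.

(** Composition is itself a bounded bilinear map, so that an expression such as
    [compl (b (f x)) (Diff g x)] is the value of a bilinear map at functions of x. *)
Definition postcomp E F G : 'L('L(F, G), 'L('L(E, F), 'L(E, G))).
Proof.
apply: (@mk_bil _ _ _ (@compl E F G) _ _ 1 ler01).
- by move=> g a f f'; apply: clinP => x /=; rewrite linearP.
- by move=> f a g g'; apply: clinP => x.
- move=> g f; rewrite mul1r; apply: clin_norm_leP => [|x]; first exact: mulr_ge0.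
  rewrite /= (le_trans (clin_norm_le _ _))//.
  by rewrite -mulrA ler_wpM2l// clin_norm_le.
Defined.

Definition precomp E F G : 'L('L(E, F), 'L('L(F, G), 'L(E, G))) :=
  flip (postcomp E F G).

Lemma postcompE E F G g f : postcomp E F G g f = compl g f.
Proof. by []. Qed.

Lemma precompE E F G g f : precomp E F G f g = compl g f.
Proof. by []. Qed.

Definition evalc E F : 'L(E, 'L('L(E, F), F)) := flip (idl 'L(E, F)).

Definition fstl E F : 'L((E * F)%type, E).
Proof.
apply: (@mk_clin (E * F)%type E fst) => //.
by exists 1 => x; rewrite mul1r prod_normE le_max lexx.
Defined.

Definition sndl E F : 'L((E * F)%type, F).
Proof.
apply: (@mk_clin (E * F)%type F snd) => //.
by exists 1 => x; rewrite mul1r prod_normE le_max lexx orbT.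
Defined.

Definition inll E F : 'L(E, (E * F)%type).
Proof.
apply: (@mk_clin E (E * F)%type (fun x => (x, 0))).
- by move=> a x y; congr pair => /=; rewrite scaler0 addr0.
- by exists 1 => x; rewrite mul1r prod_normE /= normr0 max_l.
Defined.

Definition inrl E F : 'L(F, (E * F)%type).
Proof.
apply: (@mk_clin F (E * F)%type (fun x => (0, x))).
- by move=> a x y; congr pair => /=; rewrite scaler0 addr0.
- by exists 1 => x; rewrite mul1r prod_normE /= normr0 max_r.
Defined.

Definition linel E (v : E) : 'L(R^o, E).
Proof.
apply: (@mk_clin R^o E (fun r => r *: v)).
- by move=> a x y; rewrite scalerDl scalerA.
- by exists `|v| => x; rewrite normrZ mulrC.
Defined.

End continuous_linear.

(** * Frechet derivatives *)

Section frechet.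
Context {R : realType}.
Implicit Types E F G H : normedModType R.

(** The value of [Diff f x] is meaningful only together with differentiability. *)
Definition fderiv E F (f : E -> F) (x : E) (A : 'L(E, F)) : Prop :=
  differentiable f x /\ Diff f x = A.

Lemma DiffE E F (f : E -> F) x : differentiable f x ->
  Diff f x = 'd f x :> (E -> F).
Proof.
move=> df; rewrite /Diff; apply: (@insubdK _ _ _ 0).
by apply/is_clinP; split; [exact: linearP|exact: diff_continuous].
Qed.

Lemma fderiv_is_diff E F (f : E -> F) x (A : 'L(E, F)) :
  is_diff x f A <-> fderiv f x A.
Proof.
split=> [dfA|[df <-]].
  by split=> //; apply: val_inj; rewrite /= DiffE// diff_val.
by apply: DiffDef => //; rewrite DiffE.
Qed.

Lemma fderiv_Diff E F (f : E -> F) x :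
  differentiable f x -> fderiv f x (Diff f x).
Proof. by []. Qed.

Lemma fderiv_unique E F (f : E -> F) x A B :
  fderiv f x A -> fderiv f x B -> A = B.
Proof. by move=> [_ <-] [_ <-]. Qed.

Lemma fderivP E F (f : E -> F) x (A : 'L(E, F)) :
  fderiv f x A <-> forall e : R, 0 < e ->
    \forall y \near x, `|f y - f x - A (y - x)| <= e * `|y - x|.
Proof.
have shiftP (B : E -> F) : (f \o shift x = cst (f x) + B +o_ 0 id) <->
    forall e : R, 0 < e ->
      \forall y \near x, `|f y - f x - B (y - x)| <= e * `|y - x|.
  have nearP e : (\forall y \near x, `|f y - f x - B (y - x)| <= e * `|y - x|) =
      (\forall h \near 0, `|f (h + x) - (f x + B h)| <= e * `|h|).
    rewrite (near_shift 0 x) subr0; congr (nbhs _ _); apply/funext => h /=.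
    by rewrite addrK opprD addrA.
  split=> [/eqaddoP h e e0|h]; first by rewrite nearP; exact: h.
  by apply/eqaddoP => e e0; have := h e e0; rewrite nearP.
split=> [[df <-]|/shiftP h].
  by rewrite DiffE//; apply/shiftP; exact: diff_locally.
apply/fderiv_is_diff.
have dE : 'd f x = A :> (E -> F).
  by apply: diff_unique => //; exact: clin_continuous.
apply: DiffDef => //; apply/diff_locallyP; rewrite dE; split=> //.
exact: clin_continuous.
Qed.

End frechet.

Section frechet_rules.
Context {R : realType}.
Implicit Types E F G H : normedModType R.

Lemma near_small E (x : E) (k e : R) : 0 < e ->
  \forall y \near x, k * `|y - x| <= e.
Proof.
move=> e0; near=> y.
have yx : `|y - x| <= e / (`|k| + 1).
  by near: y; apply: cvgr_distC_le => //; rewrite divr_gt0// ltr_wpDl.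
rewrite (le_trans (ler_wpM2r _ (ler_norm k)))//.
rewrite ler_pdivlMr ?ltr_wpDl// in yx.
by rewrite (le_trans _ yx)// mulrC ler_wpM2l// lerDl.
Unshelve. all: by end_near. Qed.

Lemma fderiv_near E F (f g : E -> F) x A :
  (\forall y \near x, f y = g y) -> fderiv f x A -> fderiv g x A.
Proof.
move=> fg /fderivP fA; apply/fderivP => e e0; have := fA e e0.
have fgx := nbhs_singleton fg.
by apply: filterS2 fg => y <-; rewrite fgx.
Qed.

Lemma fderiv_clin E F (A : 'L(E, F)) x : fderiv A x A.
Proof.
apply/fderivP => e e0; apply: nearW => y.
by rewrite -linearB subrr normr0 mulr_ge0// ltW.
Qed.

Lemma fderiv_cst E F (c : F) (x : E) : fderiv (fun=> c) x 0.
Proof. by apply/fderiv_is_diff. Qed.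

Lemma fderiv_comp E F G (f : E -> F) (g : F -> G) x A B :
  fderiv f x A -> fderiv g (f x) B -> fderiv (fun y => g (f y)) x (compl B A).
Proof.
move=> /fderiv_is_diff fA /fderiv_is_diff gB.
by apply/fderiv_is_diff.
Qed.

Lemma fderivD E F (f g : E -> F) x A B :
  fderiv f x A -> fderiv g x B -> fderiv (fun y => f y + g y) x (A + B).
Proof.
move=> /fderiv_is_diff fA /fderiv_is_diff gB.
by apply/fderiv_is_diff.
Qed.

Lemma fderivB E F (f g : E -> F) x A B :
  fderiv f x A -> fderiv g x B -> fderiv (fun y => f y - g y) x (A - B).
Proof.
move=> /fderiv_is_diff fA /fderiv_is_diff gB.
by apply/fderiv_is_diff.
Qed.

Lemma fderiv_pair E F G (f : E -> F) (g : E -> G) x A B :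
  fderiv f x A -> fderiv g x B ->
  fderiv (fun y => (f y, g y)) x (compl (inll F G) A + compl (inrl F G) B).
Proof.
move=> fA gB.
have := fderivD (fderiv_comp fA (fderiv_clin (inll F G) (f x)))
                (fderiv_comp gB (fderiv_clin (inrl F G) (g x))).
apply: fderiv_near; apply: nearW => y.
by congr pair; rewrite /= ?addr0 ?add0r.
Qed.

(** The error of the linear approximation is b applied to the two increments,
    hence of second order. *)
Lemma fderiv_bil E F G H (b : 'L(F, 'L(G, H))) (f : E -> F) (g : E -> G) x A B :
  fderiv f x A -> fderiv g x B ->
  fderiv (fun y => b (f y) (g y)) x
    (compl (b (f x)) B + compl (flip b (g x)) A).
Proof.
move=> fA gB.
pose D := compl (b (f x)) (sndl F G) + compl (flip b (g x)) (fstl F G).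
have bD : fderiv (fun p : (F * G)%type => b p.1 p.2) (f x, g x) D.
  apply/fderivP => e e0; near=> p.
  have -> : b p.1 p.2 - b (f x) (g x) - D (p - (f x, g x)) =
      b (p.1 - f x) (p.2 - g x).
    have -> : D (p - (f x, g x)) =
      b (f x) (p.2 - g x) + b (p.1 - f x) (g x) by [].
    have rearrange (a c d e' : H) : a - c - (d - c + (e' - c)) = a - d - (e' - c).
      by rewrite opprD addrA (opprB d c) addrA subrK.
    by rewrite !clinB !clin_subE rearrange.
  rewrite (le_trans (clin_norm_le _ _))//.
  have le2 : `|b (p.1 - f x)| <= `|b| * `|p - (f x, g x)|.
    rewrite (le_trans (clin_norm_le _ _))// ler_wpM2l//.
    by rewrite prod_normE le_max lexx.
  rewrite (le_trans (ler_wpM2r _ le2))// ler_pM ?mulr_ge0//.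
    by near: p; exact: (@near_small (F * G)%type).
  by rewrite [leRHS]prod_normE le_max lexx orbT.
have := fderiv_comp (fderiv_pair fA gB) bD.
congr fderiv; apply: clinP => h.
by rewrite /D complE !clin_addE !complE /= addr0 add0r.
Unshelve. all: by end_near. Qed.

End frechet_rules.

(** * Maps of class C^n *)

Section Cn_rules.
Context {R : realType}.
Implicit Types E F G H : normedModType R.

Lemma Diff_ext E F (U : set E) (f g : E -> F) x : open U ->
  (forall y, U y -> f y = g y) -> U x -> differentiable f x ->
  fderiv g x (Diff f x).
Proof.
move=> oU fg Ux df; apply: fderiv_near (fderiv_Diff df).
by apply: filterS (open_nbhs_nbhs (conj oU Ux)).
Qed.

Lemma Cn_ext n E F (U : set E) (f g : E -> F) : open U ->
  (forall y, U y -> f y = g y) -> Cn n U f -> Cn n U g.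
Proof.
elim: n F f g => [|n IH] F f g oU fg /=.
  move=> cf x Ux; rewrite /prop_for /continuous_at -(fg _ Ux).
  apply: cvg_trans (cf x Ux); apply: near_eq_cvg.
  by apply: filterS (open_nbhs_nbhs (conj oU Ux)) => y Uy; rewrite fg.
move=> [df cDf]; split=> [x Ux|].
  by have [] := Diff_ext oU fg Ux (df x Ux).
refine (IH _ _ _ oU _ cDf) => x Ux.
by have [_ ->] := Diff_ext oU fg Ux (df x Ux).
Qed.

Lemma Cn_sub n E F (U V : set E) (f : E -> F) :
  (U `<=` V) -> Cn n V f -> Cn n U f.
Proof.
move=> UV; elim: n F f => [|n IH] F f /=; first by move=> cf x /UV; exact: cf.
by move=> [df cf]; split=> [x /UV|]; [exact: df|exact: IH].
Qed.

Lemma CnW n E F (U : set E) (f : E -> F) : Cn n.+1 U f -> Cn n U f.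
Proof.
elim: n F f => [|n IH] F f [df cf].
  by move=> x Ux; exact: differentiable_continuous (df x Ux).
by split=> //; exact: IH.
Qed.

(** To recognize a C^(n+1) map it is enough to know a C^n map that agrees with its
    derivative on U. *)
Lemma CnS n E F (U : set E) (f : E -> F) Df : open U ->
  (forall x, U x -> fderiv f x (Df x)) -> Cn n U Df -> Cn n.+1 U f.
Proof.
move=> oU fDf cDf; split=> [x Ux|]; first by have [] := fDf x Ux.
by apply: Cn_ext cDf => // x Ux; have [_ ->] := fDf x Ux.
Qed.

Lemma Cn_cst n E F (U : set E) (c : F) : open U -> Cn n U (fun=> c).
Proof.
move=> oU; elim: n F c => [|n IH] F c; first by move=> x _; exact: cst_continuous.
by apply: (CnS oU _ (IH _ 0)) => x _; exact: fderiv_cst.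
Qed.

Lemma Cn_clin n E F (U : set E) (A : 'L(E, F)) : open U -> Cn n U A.
Proof.
move=> oU; case: n => [|n]; first by move=> x _; exact: clin_continuous.
by apply: (CnS oU _ (Cn_cst _ A oU)) => x _; exact: fderiv_clin.
Qed.

Lemma Cn_post n E F G (U : set E) (A : 'L(F, G)) (f : E -> F) : open U ->
  Cn n U f -> Cn n U (fun x => A (f x)).
Proof.
move=> oU; elim: n F G A f => [|n IH] F G A f /=.
  move=> cf x Ux; apply: (@continuous_comp _ _ _ f A); first exact: cf.
  exact: clin_continuous.
move=> [df cDf].
apply: (@CnS n _ _ _ _ (fun x => postcomp E F G A (Diff f x)) oU); last exact: IH.
move=> x Ux; apply: fderiv_comp; last exact: fderiv_clin.
exact: fderiv_Diff (df x Ux).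
Qed.

Lemma CnD n E F (U : set E) (f g : E -> F) : open U ->
  Cn n U f -> Cn n U g -> Cn n U (fun x => f x + g x).
Proof.
move=> oU; elim: n F f g => [|n IH] F f g /=.
  by move=> cf cg x Ux; apply: continuousD; [exact: cf|exact: cg].
move=> [df cDf] [dg cDg].
apply: (@CnS n _ _ _ _ (fun x => Diff f x + Diff g x) oU); last exact: IH.
by move=> x Ux; apply: fderivD; apply: fderiv_Diff; [exact: df|exact: dg].
Qed.

(** The derivative is the sum of the bilinear expressions in (f, Dg) and in
    (Df, g); these involve other bilinear maps between other spaces, over which
    the induction hypothesis has to range. *)
Lemma Cn_bil n E F G H (U : set E) (b : 'L(F, 'L(G, H))) (f : E -> F)
    (g : E -> G) : open U ->
  Cn n U f -> Cn n U g -> Cn n U (fun x => b (f x) (g x)).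
Proof.
move=> oU; elim: n F G H b f g => [|n IH] F G H b f g.
  move=> cf cg x Ux.
  have bc (p : (F * G)%type) : {for p, continuous (fun p => b p.1 p.2)}.
    apply: differentiable_continuous.
    by have [] := fderiv_bil b (fderiv_clin (fstl F G) p) (fderiv_clin (sndl F G) p).
  apply: (@continuous_comp _ _ _ (fun x => (f x, g x)) (fun p => b p.1 p.2)).
    by apply: cvg_pair; [exact: cf|exact: cg].
  exact: bc.
move=> cf cg; have [[df cDf] [dg cDg]] := (cf, cg).
apply: (@CnS n _ _ _ _ (fun x =>
    postcomp E G H (b (f x)) (Diff g x) +
    postcomp E F H (flip b (g x)) (Diff f x)) oU).
  move=> x Ux; apply: fderiv_bil; apply: fderiv_Diff; [exact: df|exact: dg].
apply: CnD => //; apply: (IH) => //; apply: Cn_post => //; exact: CnW.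
Qed.

(** The derivative is bilinear in (Dg) o f, to which the induction hypothesis
    applies, and Df. *)
Lemma Cn_comp n E F G (U : set E) (V : set F) (f : E -> F) (g : F -> G) :
  open U -> (forall x, U x -> V (f x)) ->
  Cn n U f -> Cn n V g -> Cn n U (fun x => g (f x)).
Proof.
move=> oU UV; elim: n G g => [|n IH] G g.
  by move=> cf cg x Ux; apply: (@continuous_comp _ _ _ f g); [exact: cf|exact/cg/UV].
move=> cf [dg cDg]; have [df cDf] := cf.
apply: (@CnS n _ _ _ _ (fun x => postcomp E F G (Diff g (f x)) (Diff f x)) oU).
  by move=> x Ux; apply: fderiv_comp; apply: fderiv_Diff; [exact: df|exact/dg/UV].
by apply: Cn_bil => //; apply: IH => //; exact: CnW.
Qed.

Lemma Cn_pair n E F G (U : set E) (f : E -> F) (g : E -> G) : open U ->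
  Cn n U f -> Cn n U g -> Cn n U (fun x => (f x, g x)).
Proof.
move=> oU cf cg.
apply: (@Cn_ext n E _ U (fun x => inll F G (f x) + inrl F G (g x))) => //.
  by move=> x _; congr pair; rewrite /= ?addr0 ?add0r.
by apply: CnD => //; exact: Cn_post.
Qed.

End Cn_rules.

Section smooth_rules.
Context {R : realType}.
Implicit Types E F G H : normedModType R.

Lemma smooth_on_open E F (U : set E) (f : E -> F) : smooth_on U f -> open U.
Proof. by case. Qed.

Lemma smooth_differentiable E F (U : set E) (f : E -> F) x :
  smooth_on U f -> U x -> differentiable f x.
Proof. by move=> [_ /(_ 1%N)[df _]] /df. Qed.

Lemma smooth_fderiv E F (U : set E) (f : E -> F) x :
  smooth_on U f -> U x -> fderiv f x (Diff f x).
Proof. by move=> sf Ux; exact/fderiv_Diff/smooth_differentiable/Ux. Qed.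

Lemma smooth_Diff E F (U : set E) (f : E -> F) :
  smooth_on U f -> smooth_on U (Diff f).
Proof. by move=> [oU cf]; split=> // n; have [] := cf n.+1. Qed.

Lemma smooth_ext E F (U : set E) (f g : E -> F) :
  (forall y, U y -> f y = g y) -> smooth_on U f -> smooth_on U g.
Proof. by move=> fg [oU cf]; split=> // n; exact: Cn_ext (cf n). Qed.

Lemma smooth_sub E F (U V : set E) (f : E -> F) :
  open U -> U `<=` V -> smooth_on V f -> smooth_on U f.
Proof. by move=> oU UV [oV cf]; split=> // n; exact: Cn_sub (cf n). Qed.

Lemma smooth_cst E F (U : set E) (c : F) : open U -> smooth_on U (fun=> c).
Proof. by move=> oU; split=> // n; exact: Cn_cst. Qed.

Lemma smooth_clin E F (U : set E) (A : 'L(E, F)) : open U -> smooth_on U A.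
Proof. by move=> oU; split=> // n; exact: Cn_clin. Qed.

Lemma smooth_post E F G (U : set E) (A : 'L(F, G)) (f : E -> F) :
  smooth_on U f -> smooth_on U (fun x => A (f x)).
Proof. by move=> [oU cf]; split=> // n; exact: Cn_post. Qed.

Lemma smoothD E F (U : set E) (f g : E -> F) :
  smooth_on U f -> smooth_on U g -> smooth_on U (fun x => f x + g x).
Proof. by move=> [oU cf] [_ cg]; split=> // n; exact: CnD. Qed.

Lemma smoothN E F (U : set E) (f : E -> F) :
  smooth_on U f -> smooth_on U (fun x => - f x).
Proof. by move=> /(smooth_post (- idl F)). Qed.

Lemma smooth_bil E F G H (U : set E) (b : 'L(F, 'L(G, H))) f g :
  smooth_on U f -> smooth_on U g -> smooth_on U (fun x => b (f x) (g x)).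
Proof. by move=> [oU cf] [_ cg]; split=> // n; exact: Cn_bil. Qed.

Lemma smooth_comp E F G (U : set E) (V : set F) (f : E -> F) (g : F -> G) :
  (forall x, U x -> V (f x)) ->
  smooth_on U f -> smooth_on V g -> smooth_on U (fun x => g (f x)).
Proof. by move=> UV [oU cf] [oV cg]; split=> // n; exact: Cn_comp UV _ _. Qed.

Lemma smooth_pair E F G (U : set E) (f : E -> F) (g : E -> G) :
  smooth_on U f -> smooth_on U g -> smooth_on U (fun x => (f x, g x)).
Proof. by move=> [oU cf] [_ cg]; split=> // n; exact: Cn_pair. Qed.

End smooth_rules.

(** * Smoothness of inversion *)

Section inversion.
Context {R : realType}.
Implicit Types E F G H : normedModType R.

Lemma compl_norm_le E F G (g : 'L(F, G)) (f : 'L(E, F)) :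
  `|compl g f| <= `|g| * `|f|.
Proof.
apply: clin_norm_leP => [|x]; first exact: mulr_ge0.
by rewrite complE (le_trans (clin_norm_le _ _))// -mulrA ler_wpM2l// clin_norm_le.
Qed.

Lemma fderiv_growth E F (f : E -> F) x A : fderiv f x A ->
  \forall y \near x, `|f y - f x| <= (`|A| + 1) * `|y - x|.
Proof.
move=> /fderivP/(_ _ ltr01); apply: filterS => y fy.
rewrite -(subrK (A (y - x)) (f y - f x)) (le_trans (ler_normD _ _))//.
by rewrite addrC mulrDl lerD// clin_norm_le.
Qed.

(** Continuity of [f] is enough because [g] vanishes at [x]: replacing [f y] by
    [f x] changes the value by (f y - f x) times a quantity of order y - x. This
    turns the resolvent identity below into a derivative of the inverse. *)
Lemma fderiv_bil0 E F G H (b : 'L(F, 'L(G, H))) (f : E -> F) (g : E -> G) x B :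
  {for x, continuous f} -> fderiv g x B -> g x = 0 ->
  fderiv (fun y => b (f y) (g y)) x (compl (b (f x)) B).
Proof.
move=> cf gB gx0.
have rest : fderiv (fun y => b (f y - f x) (g y)) x 0.
  apply/fderivP => e e0.
  have k0 : 0 < `|b| * (`|B| + 1) + 1 by rewrite ltr_wpDl// mulr_ge0// addr_ge0.
  near=> y.
  rewrite subrr clin0 !subr0.
  have fy : `|f y - f x| <= e / (`|b| * (`|B| + 1) + 1).
    by near: y; apply: cvgr_distC_le => //; exact: divr_gt0.
  have gy : `|g y| <= (`|B| + 1) * `|y - x|.
    by rewrite -[g y]subr0 -gx0; near: y; exact: fderiv_growth.
  rewrite (le_trans (clin_norm_le _ _))//.
  rewrite (le_trans (ler_pM _ _ (clin_norm_le _ _) gy))//.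
  rewrite mulrA ler_wpM2r// mulrAC.
  rewrite ler_pdivlMr// in fy; rewrite (le_trans _ fy)// mulrC ler_wpM2l//.
  by rewrite lerDl.
have := fderivD rest (fderiv_comp gB (fderiv_clin (b (f x)) (g x))).
rewrite add0r; apply: fderiv_near; apply: nearW => y.
by rewrite clinB clin_subE subrK.
Unshelve. all: by end_near. Qed.

Section inverse.
Context {E F G : normedModType R} (U : set E).
Variables (A : E -> 'L(F, G)) (B : E -> 'L(G, F)).
Hypothesis oU : open U.
Hypothesis BA : forall x, U x -> forall v, B x (A x v) = v.
Hypothesis AB : forall x, U x -> forall w, A x (B x w) = w.

(** The resolvent identity: multiply A(y) - A(x) by B(y) and B(x). *)
Let resolvent x y : U x -> U y ->
  B y = B x - postcomp G G F (B y) (precomp G F G (B x) (A y - A x)).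
Proof.
move=> Ux Uy; apply: clinP => w.
by rewrite clin_subE postcompE precompE !complE clin_subE clinB BA// AB// opprB addrC subrK.
Qed.

(** Near x the norm of (A(y) - A(x)) B(x) is at most 1/2, so that the second term
    of the resolvent identity is at most half of B(y) and can be absorbed. *)
Let B_bounded x : U x -> {for x, continuous A} ->
  \forall y \near x, `|B y| <= 2 * `|B x|.
Proof.
move=> Ux cA; near=> y.
have Uy : U y by near: y; exact: open_nbhs_nbhs.
have Ay : `|A y - A x| <= (2 * (`|B x| + 1))^-1.
  near: y; apply: cvgr_distC_le => //.
  by rewrite invr_gt0 mulr_gt0// ltr_wpDl.
rewrite -[_^-1]mul1r ler_pdivlMr ?mulr_gt0 ?ltr_wpDl// in Ay.
have : `|B y| <= `|B x| + `|B y| * (`|A y - A x| * `|B x|).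
  rewrite {1}(resolvent Ux Uy) (le_trans (ler_normB _ _))// lerD2l.
  rewrite (le_trans (compl_norm_le _ _))// ler_wpM2l//.
  exact: compl_norm_le.
have : `|B y| * (`|A y - A x| * `|B x|) <= `|B y| / 2.
  rewrite ler_wpM2l// -[leRHS]mul1r ler_pdivlMr// -mulrA (le_trans _ Ay)//.
  by rewrite ler_wpM2l// mulrC ler_wpM2l// lerDl.
move=> h1 h2; rewrite mulrC -ler_pdivrMr//.
move: (le_trans h2 (lerD (lexx _) h1)).
by rewrite -lerBlDr {1}[`|B y|]splitr addrK.
Unshelve. all: by end_near. Qed.

Let B_continuous x : U x -> {for x, continuous A} -> {for x, continuous B}.
Proof.
move=> Ux cA; apply/cvgrPdist_le => e e0.
have k0 : 0 < 2 * `|B x| * `|B x| + 1 by rewrite ltr_wpDl// !mulr_ge0.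
near=> y.
have Uy : U y by near: y; exact: open_nbhs_nbhs.
have By : `|B y| <= 2 * `|B x| by near: y; exact: B_bounded.
have Ay : `|A y - A x| <= e / (2 * `|B x| * `|B x| + 1).
  by near: y; apply: cvgr_distC_le => //; exact: divr_gt0.
rewrite ler_pdivlMr// in Ay.
rewrite [in leLHS](resolvent Ux Uy) opprB addrC subrK.
rewrite (le_trans (compl_norm_le _ _))//.
rewrite (le_trans (ler_pM _ _ By (compl_norm_le _ _)))//.
rewrite mulrCA (le_trans _ Ay)// ler_wpM2l//.
by rewrite lerDl.
Unshelve. all: by end_near. Qed.

Lemma fderiv_inverse x : U x -> differentiable A x ->
  fderiv B x (- compl (postcomp G G F (B x))
                      (compl (precomp G F G (B x)) (Diff A x))).
Proof.
move=> Ux dA; have cA : {for x, continuous A} := differentiable_continuous dA.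
have dAx := fderivB (fderiv_Diff dA) (fderiv_cst (A x) x).
rewrite subr0 in dAx.
have h0 : precomp G F G (B x) (A x - A x) = 0 by rewrite subrr clin0.
have := fderivB (fderiv_cst (B x) x)
  (fderiv_bil0 (postcomp G G F) (B_continuous Ux cA)
     (fderiv_comp dAx (fderiv_clin (precomp G F G (B x)) _)) h0).
rewrite sub0r; apply: fderiv_near.
by apply: filterS (open_nbhs_nbhs (conj oU Ux)) => y Uy; rewrite -resolvent.
Qed.

(** DB = - B . DA . B involves no derivative of B, so that its class C^n follows
    from the class C^n of B and of DA. *)
Lemma Cn_inverse n : Cn n U A -> Cn n U B.
Proof.
elim: n => [|n IH] cA; first by move=> x Ux; exact/B_continuous/cA.
have [dA cDA] := cA; have cB : Cn n U B by apply: IH; exact: CnW.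
apply: (CnS oU (fun x Ux => fderiv_inverse Ux (dA x Ux))).
apply: (Cn_post (- idl _) oU).
apply: (Cn_bil (postcomp _ _ _) oU); first exact: Cn_post.
by apply: (Cn_bil (postcomp _ _ _) oU) => //; exact: Cn_post.
Qed.

Lemma smooth_inverse : smooth_on U A -> smooth_on U B.
Proof. by move=> [_ cA]; split=> // n; exact: Cn_inverse. Qed.

End inverse.
End inversion.

(** * Symmetry of second derivatives *)

Section symmetry.
Context {R : realType}.
Implicit Types E F G H : normedModType R.

(** For every slope C + e, the points t where the norm of phi(t) - phi(0) is at
    most (C + e) t have a supremum T. The estimate holds at T by continuity, and differentiability
    at T extends it a little beyond T; hence T = 1. *)
Lemma mean_value_unit F (phi : R^o -> F) (C : R) : 0 <= C ->
  (forall t, 0 <= t <= 1 -> exists2 D, fderiv phi t D & `|D| <= C) ->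
  `|phi 1 - phi 0| <= C.
Proof.
move=> C0 dphi; apply/ler_addgt0Pr => e e0.
pose S : set R := [set t | 0 <= t <= 1 /\ `|phi t - phi 0| <= (C + e) * t].
have S0 : S 0 by split; rewrite ?lexx ?ler01// subrr normr0 mulr0.
have hS : has_sup S by split; [exists 0|exists 1 => t [/andP[]]].
pose T : R^o := sup S.
have T0 : 0 <= T by exact: ub_le_sup (proj2 hS) _ S0.
have T1 : T <= 1 by apply: ge_sup; [exists 0|move=> t [/andP[]]].
have [D dT DC] := dphi T (introT andP (conj T0 T1)).
have cT : {for T, continuous phi} by apply: differentiable_continuous; case: dT.
have ST : `|phi T - phi 0| <= (C + e) * T.
  rewrite leNgt; apply/negP; rewrite -subr_gt0 => gap.
  have [d /= d0 near_T] := (nbhs_ballP _ _).1 (cvgr_dist_lt _ _ cT _ gap).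
  have [t [t01 St] Tt] := sup_adherent d0 hS.
  have tT : t <= T by exact: ub_le_sup (proj2 hS) _ (conj t01 St).
  have : `|phi T - phi t| < `|phi T - phi 0| - (C + e) * T.
    apply: near_T; rewrite -ball_normE /= ger0_norm ?subr_ge0//.
    by rewrite ltrBlDr addrC -ltrBlDr.
  apply/negP; rewrite -leNgt lerBlDr.
  rewrite -(subrK (phi t) (phi T)) -addrA addrK (le_trans (ler_normD _ _))//.
  by rewrite lerD2l (le_trans St)// ler_wpM2l// addr_ge0// ltW.
have [T1'|T1'] := ltP T 1; last first.
  have T1E : T = 1 by apply/le_anti; rewrite T1 T1'.
  by move: ST; rewrite T1E mulr1.
have [d /= d0 near_T] := (nbhs_ballP _ _).1 ((fderivP _ _ _).1 dT e e0).
(* a point of ]T, 1] at distance less than d from T *)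
pose t := T + Num.min (d / 2) (1 - T).
have Tt : T < t by rewrite ltrDl lt_min divr_gt0//= subr_gt0.
have t1 : t <= 1 by rewrite -lerBrDl ge_min lexx orbT.
suff /(ub_le_sup (proj2 hS)) : S t by rewrite leNgt Tt.
have tT0 : 0 <= t - T by rewrite subr_ge0 ltW.
split; first by rewrite t1 andbT (le_trans T0)// ltW.
have := near_T t; rewrite -ball_normE /= distrC ger0_norm//.
have -> : t - T < d.
  rewrite /t addrC addKr gt_min.
  by rewrite ltr_pdivrMr// ltr_pMr// ltr1n.
move=> /(_ isT) step.
rewrite -(subrK (phi T) (phi t)) -addrA (le_trans (ler_normD _ _))//.
rewrite -[X in (C + e) * X](subrK T) mulrDr lerD//.
rewrite -(subrK (D (t - T)) (phi t - phi T)) (le_trans (ler_normD _ _))//.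
rewrite addrC mulrDl lerD// (le_trans (clin_norm_le _ _))//.
by rewrite [X in _ * X]ger0_norm// ler_wpM2r.
Qed.

(** The mean value inequality is applied to the difference of f along the two
    sides parallel to v; its derivative in the direction of v is an increment of
    Df near x, which A approximates. *)
Lemma second_difference E F (f : E -> F) (x : E) (A : 'L(E, 'L(E, F))) (d e : R)
    (u v : E) (s : R) :
  0 <= e ->
  (forall y, `|y - x| < d -> differentiable f y /\
    `|Diff f y - Diff f x - A (y - x)| <= e * `|y - x|) ->
  0 < s -> s * (`|u| + `|v|) < d ->
  `|f (x + s *: u + s *: v) - f (x + s *: v) - (f (x + s *: u) - f x)
     - s ^+ 2 *: A u v| <= s ^+ 2 * (e * (2 * (`|u| + `|v|) * `|v|)).
Proof.
move=> e0 fA s0 sd.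
(* what remains of the second difference, as a function of the length t of the
   sides parallel to v *)
pose phi (t : R^o) := f (x + s *: u + t *: (s *: v)) - f (x + t *: (s *: v))
   - t *: (s ^+ 2 *: A u v).
have -> : f (x + s *: u + s *: v) - f (x + s *: v) - (f (x + s *: u) - f x)
     - s ^+ 2 *: A u v = phi 1 - phi 0.
  by rewrite /phi !scale1r !scale0r !addr0 subr0 addrAC.
have C0 : 0 <= e * (2 * (`|u| + `|v|) * `|v|) by rewrite !mulr_ge0// addr_ge0.
apply: mean_value_unit; first by rewrite mulr_ge0// sqr_ge0.
move=> t /andP[t0 t1].
have path y : `|y| <= `|u| -> `|s *: y + t *: (s *: v)| <= s * (`|u| + `|v|).
  move=> yu; rewrite (le_trans (ler_normD _ _))// !normrZ (ger0_norm t0).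
  rewrite gtr0_norm// mulrDr lerD// ?(ler_wpM2l (ltW s0))//.
  by rewrite ler_piMl// mulr_ge0// ltW.
have path1 := path u (lexx _).
have path2 : `|t *: (s *: v)| <= s * (`|u| + `|v|).
  by have := path 0; rewrite normr0 scaler0 add0r; apply.
pose y1 := x + s *: u + t *: (s *: v); pose y2 := x + t *: (s *: v).
have y1x : y1 - x = s *: u + t *: (s *: v) by rewrite /y1 addrC -addrA addKr.
have y2x : y2 - x = t *: (s *: v) by rewrite /y2 addrC addKr.
have [d1 b1] : differentiable f y1 /\
    `|Diff f y1 - Diff f x - A (y1 - x)| <= e * `|y1 - x|.
  by apply: fA; rewrite y1x (le_lt_trans path1).
have [d2 b2] : differentiable f y2 /\
    `|Diff f y2 - Diff f x - A (y2 - x)| <= e * `|y2 - x|.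
  by apply: fA; rewrite y2x (le_lt_trans path2).
have line (c : E) : fderiv (fun r : R^o => c + r *: (s *: v)) t (linel (s *: v)).
  have := fderivD (fderiv_cst c t) (fderiv_clin (linel (s *: v)) t).
  by rewrite add0r.
have := fderivB (fderivB (fderiv_comp (line (x + s *: u)) (fderiv_Diff d1))
                 (fderiv_comp (line x) (fderiv_Diff d2)))
         (fderiv_clin (linel (s ^+ 2 *: A u v)) t).
set D := (_ - _ - _) => dphi; exists D => //.
apply: clin_norm_leP => [|r]; first by rewrite mulr_ge0// sqr_ge0.
have -> : D r = (r * s) *: ((Diff f y1 - Diff f x - A (y1 - x)) v
                  - (Diff f y2 - Diff f x - A (y2 - x)) v).
  have rearrange (p0 p1 p2 a w : F) :
      p1 - p0 - (a + w) - (p2 - p0 - w) = p1 - p2 - a.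
    rewrite opprD addrA (addrAC p1) -addrA -opprD.
    by rewrite -[p2 - p0 - w]addrA -opprD opprB subrKA addrAC.
  have -> : D r = Diff f y1 (r *: (s *: v)) - Diff f y2 (r *: (s *: v))
                  - r *: (s ^+ 2 *: A u v) by [].
  rewrite y1x y2x clinD !(clin_subE _ _ v) clin_addE rearrange.
  by rewrite !clinZ !scalerBr !scalerA expr2 mulrA.
rewrite normrZ normrM (gtr0_norm s0) mulrAC [leRHS]mulrC -mulrA ler_wpM2l//.
rewrite mulrC expr2 -!mulrA ler_wpM2l ?(ltW s0)//.
rewrite (le_trans (ler_normB _ _))//.
rewrite (le_trans (lerD (clin_norm_le _ _) (clin_norm_le _ _)))// -mulrDl.
rewrite !mulrA ler_wpM2r//.
rewrite (le_trans (lerD b1 b2))// -mulrDr y1x y2x (mulrC s) -!mulrA ler_wpM2l//.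
by rewrite (le_trans (lerD path1 path2))// -mulrDr mulr_natl mulr2n.
Qed.

(** The second difference of f along a parallelogram does not depend on the order
    of its sides, and it approximates both s^2 A u v and s^2 A v u. *)
Lemma second_derivative_sym E F (f : E -> F) (U : set E) x
    (A : 'L(E, 'L(E, F))) : open U -> U x ->
  (forall y, U y -> differentiable f y) -> fderiv (Diff f) x A ->
  forall u v, A u v = A v u.
Proof.
move=> oU Ux df /fderivP fA u v.
apply/eqP; rewrite -subr_eq0 -normr_le0; apply/ler_addgt0Pr => e e0.
rewrite add0r.
pose N := `|u| + `|v|.
have N0 : 0 <= N by rewrite addr_ge0.
(* the two applications of the estimate have total error at most s^2 (e / k) k *)
pose k := 2 * N * `|v| + 2 * N * `|u| + 1.
have k0 : 0 < k by rewrite ltr_wpDl// addr_ge0// !mulr_ge0.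
have e'0 : 0 < e / k by rewrite divr_gt0.
have [d /= d0 dfA] :=
  (nbhs_ballP _ _).1 (filterI (open_nbhs_nbhs (conj oU Ux)) (fA _ e'0)).
(* small enough for the parallelogram to stay in the ball of radius d *)
pose s := d / (N + 1).
have N1 : 0 < N + 1 by rewrite ltr_wpDl.
have s0 : 0 < s by rewrite divr_gt0.
have sd : s * N < d by rewrite /s mulrAC ltr_pdivrMr// ltr_pM2l// ltrDl.
have fA' y : `|y - x| < d -> differentiable f y /\
    `|Diff f y - Diff f x - A (y - x)| <= e / k * `|y - x|.
  by move=> yx; have [|Uy ?] := dfA y;
    [rewrite -ball_normE /= distrC|split=> //; exact: df].
have huv := second_difference (ltW e'0) fA' s0 sd.
have hvu : s * (`|v| + `|u|) < d by rewrite (addrC `|v|).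
have {}hvu := second_difference (ltW e'0) fA' s0 hvu.
have s2 : 0 < s ^+ 2 by rewrite exprn_gt0.
rewrite -(ler_pM2l s2) -[X in X * _](gtr0_norm s2) -normrZ scalerBr.
set Auv := s ^+ 2 *: A u v in huv *; set Avu := s ^+ 2 *: A v u in hvu *.
rewrite (addrAC x (s *: v)) in hvu.
set fuv := f (x + s *: u + s *: v) in huv hvu.
have Q : fuv - f (x + s *: u) - (f (x + s *: v) - f x) =
         fuv - f (x + s *: v) - (f (x + s *: u) - f x).
  by rewrite !opprB !addrA [LHS]addrAC [RHS]addrAC (addrAC fuv).
rewrite {}Q in hvu; set Q := (_ - (f (x + s *: u) - f x)) in huv hvu.
have -> : Auv - Avu = (Q - Avu) - (Q - Auv).
  by rewrite opprB [in RHS]addrC subrKA.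
rewrite (le_trans (ler_normB _ _))// (le_trans (lerD hvu huv))//.
rewrite -mulrDr (ler_wpM2l (ltW s2))//.
rewrite -mulrDr mulrAC ler_pdivrMr// (ler_wpM2l (ltW e0))//.
by rewrite (addrC `|v| `|u|) -/N addrC lerDl.
Qed.

End symmetry.

(** * Curves in a normed space *)

Section curves.
Context {R : realType}.
Implicit Types E F G H : normedModType R.

Lemma fderiv_is_derive E (x : R^o -> E) t A :
  fderiv x t A -> is_derive t 1 x (A 1).
Proof.
move=> [dx xA]; have dv : derivable x t (1 : R^o) by exact: diff_derivable.
by apply: (is_derive_eq (derivableP dv)); rewrite deriveE// -xA DiffE.
Qed.

Lemma fderiv_derive1 E (x : R^o -> E) t A :
  fderiv x t A -> (x : R -> E)^`()%classic t = A 1.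
Proof. by move=> /fderiv_is_derive xA; rewrite derive1E derive_val. Qed.

Lemma clin_linel E (A : 'L(R^o, E)) : A = linel (A 1).
Proof.
by apply: clinP => r /=; rewrite -clinZ; congr (A _); exact/esym/mulr1.
Qed.

Lemma smooth_derive1E E (U : set R^o) (x : R^o -> E) t : smooth_on U x -> U t ->
  (x : R -> E)^`()%classic t = Diff x t 1.
Proof. by move=> sx Ut; exact: fderiv_derive1 (smooth_fderiv sx Ut). Qed.

Lemma smooth_derive1 E (U : set R^o) (x : R^o -> E) : smooth_on U x ->
  smooth_on U ((x : R -> E)^`()%classic : R^o -> E).
Proof.
move=> sx; apply: (smooth_ext (f := fun t => evalc R^o E 1 (Diff x t))).
  by move=> t Ut; rewrite (smooth_derive1E sx Ut).
exact: smooth_post (smooth_Diff sx).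
Qed.

Lemma derive1_near E (x y : R -> E) t :
  (\forall s \near (t : R^o), x s = y s) -> x^`()%classic t = y^`()%classic t.
Proof. by move=> xy; rewrite !derive1E; exact: near_eq_derive. Qed.

Lemma smooth_fderiv_curve E (U : set R^o) (x : R^o -> E) t :
  smooth_on U x -> U t -> fderiv x t (linel ((x : R -> E)^`()%classic t)).
Proof.
move=> sx Ut; rewrite (smooth_derive1E sx Ut) -clin_linel.
exact: smooth_fderiv sx Ut.
Qed.

Lemma fderiv_curve_pair E F (x : R^o -> E) (y : R^o -> F) t v w :
  fderiv x t (linel v) -> fderiv y t (linel w) ->
  fderiv (fun s => (x s, y s)) t (linel (v, w)).
Proof.
move=> hx hy; have := fderiv_pair hx hy; congr fderiv; apply: clinP => r.
by rewrite clin_addE !complE; congr pair; [exact: addr0|exact: add0r].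
Qed.

Lemma fderiv_curve_id (t : R^o) : fderiv (fun s : R^o => s) t (linel (1 : R^o)).
Proof.
have := fderiv_clin (idl R^o) t; congr fderiv; apply: clinP => r /=.
by rewrite [RHS]mulr1.
Qed.

Lemma derive1_comp_smooth E F (U : set R^o) (x : R^o -> E) (h : E -> F) t :
  smooth_on U x -> U t -> differentiable h (x t) ->
  (fun s : R => h (x s))^`()%classic t = Diff h (x t) ((x : R -> E)^`()%classic t).
Proof.
move=> sx Ut dh.
rewrite (fderiv_derive1 (fderiv_comp (smooth_fderiv_curve sx Ut) (fderiv_Diff dh))).
by rewrite complE /= scale1r.
Qed.

(** This is why second derivatives of curves are not tangent vectors: the first
    term is quadratic in the velocity. *)
Lemma derive2_comp_smooth E F (U : set R^o) (V : set E) (x : R^o -> E)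
    (h : E -> F) t : smooth_on U x -> smooth_on V h ->
  (forall s, U s -> V (x s)) -> U t ->
  (fun s : R => h (x s))^`(2)%classic t =
    Diff (Diff h) (x t) ((x : R -> E)^`()%classic t) ((x : R -> E)^`()%classic t)
    + Diff h (x t) ((x : R -> E)^`(2)%classic t).
Proof.
move=> sx sh UV Ut.
have dhx s : U s ->
    (fun s : R => h (x s))^`()%classic s = Diff h (x s) ((x : R -> E)^`()%classic s).
  by move=> Us; apply: (derive1_comp_smooth sx Us); exact: smooth_differentiable (UV _ Us).
rewrite derive1nS derive1n1.
rewrite (@derive1_near _ _ (fun s => Diff h (x s) ((x : R -> E)^`()%classic s))); last first.
  by apply: filterS (open_nbhs_nbhs (conj (smooth_on_open sx) Ut)).
have dDh := fderiv_comp (smooth_fderiv_curve sx Ut)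
                        (smooth_fderiv (smooth_Diff sh) (UV _ Ut)).
have := fderiv_bil (idl 'L(E, F)) dDh (smooth_fderiv_curve (smooth_derive1 sx) Ut).
move=> /fderiv_derive1 ->.
by rewrite clin_addE !complE /= !scale1r addrC.
Qed.

Definition scalel E : 'L(R^o, 'L(E, E)).
Proof.
apply: (@mk_bil R R^o E E (fun r v => r *: v) _ _ 1 ler01).
- by move=> r a v w; rewrite scalerDr !scalerA mulrC.
- by move=> v a r s; rewrite scalerDl scalerA.
- by move=> r v; rewrite mul1r normrZ.
Defined.

(** Every triple (x, y, a) is the 2-jet at 0 of such a curve. *)
Definition parabola E (x y a : E) (s : R^o) : E :=
  x + s *: y + s *: (s *: (2^-1 *: a)).

Lemma parabola_smooth E (x y a : E) : smooth_on setT (parabola x y a).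
Proof.
apply: smoothD; last first.
  apply: (smooth_bil (scalel E) (f := idl R^o) (g := linel (2^-1 *: a))).
    exact: smooth_clin openT.
  exact: smooth_clin openT.
by apply: smoothD; [exact: smooth_cst openT|exact: (smooth_clin (linel y) openT)].
Qed.

Lemma parabola0 E (x y a : E) : parabola x y a 0 = x.
Proof. by rewrite /parabola !scale0r !addr0. Qed.

Lemma parabola_derive1 E (x y a : E) (s : R) :
  (parabola x y a : R -> E)^`()%classic s = y + s *: a.
Proof.
have := fderiv_bil (scalel E) (fderiv_clin (idl R^o) s)
          (fderiv_clin (linel (2^-1 *: a)) s).
have := fderivD (fderiv_cst x s) (fderiv_clin (linel y) s).
move=> h1 h2; have /fderiv_derive1 := fderivD h1 h2.
rewrite !clin_addE !complE /= => ->.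
rewrite !scale1r; congr (_ + _); first by rewrite [LHS]add0r.
by rewrite -scalerDr -scalerDl -[2^-1]mul1r -splitr scale1r.
Qed.

Lemma parabola_derive2 E (x y a : E) : (parabola x y a : R -> E)^`(2)%classic 0 = a.
Proof.
rewrite derive1nS derive1n1.
have -> : (parabola x y a : R -> E)^`()%classic = (fun s : R^o => y + linel a s).
  by apply/funext => s; rewrite parabola_derive1.
have /fderiv_derive1 -> := fderivD (fderiv_cst y 0) (fderiv_clin (linel a) 0).
by rewrite add0r /= scale1r.
Qed.

End curves.

(** * The Euler-Lagrange equation in a chart *)

Section prolongation.
Context {R : realType}.
Implicit Types E F G : normedModType R.

Lemma smooth_fst E F G (V : set E) (h : E -> G) :
  smooth_on V h -> smooth_on [set p : (E * F)%type | V p.1] (fun p => h p.1).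
Proof.
move=> sh; have oV : open [set p : (E * F)%type | V p.1].
  apply: (@open_comp _ _ (fst : E * F -> E)); last exact: smooth_on_open sh.
  by move=> p _; exact: (@clin_continuous _ _ _ (fstl E F)).
exact: (smooth_comp (V := V) _ (smooth_clin (fstl E F) oV)).
Qed.

Lemma smooth_snd E F G (V : set F) (h : F -> G) :
  smooth_on V h -> smooth_on [set p : (E * F)%type | V p.2] (fun p => h p.2).
Proof.
move=> sh; have oV : open [set p : (E * F)%type | V p.2].
  apply: (@open_comp _ _ (snd : E * F -> F)); last exact: smooth_on_open sh.
  by move=> p _; exact: (@clin_continuous _ _ _ (sndl E F)).
exact: (smooth_comp (V := V) _ (smooth_clin (sndl E F) oV)).
Qed.

Definition tangent_map E F (h : E -> F) (p : (E * E)%type) : (F * F)%type :=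
  (h p.1, Diff h p.1 p.2).

Definition time_map E F (h : E -> F) (p : (R^o * E)%type) : (R^o * F)%type :=
  (p.1, h p.2).

Lemma smooth_tangent_map E F (V : set E) (h : E -> F) : smooth_on V h ->
  smooth_on [set p : (E * E)%type | V p.1] (tangent_map h).
Proof.
move=> sh; have sf := smooth_fst E sh.
apply: smooth_pair => //.
apply: (smooth_bil (idl _) (f := fun p : (E * E)%type => Diff h p.1) (g := sndl E E)).
  exact: (smooth_fst E (smooth_Diff sh)).
exact/smooth_clin/smooth_on_open/sf.
Qed.

Lemma smooth_time_map E F (V : set E) (h : E -> F) : smooth_on V h ->
  smooth_on [set p : (R^o * E)%type | V p.2] (time_map h).
Proof.
move=> sh; have sf := smooth_snd R^o sh.
apply: smooth_pair => //.
exact: (smooth_clin (fstl R^o E) (smooth_on_open sf)).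
Qed.

Lemma fderiv_tangent_map E F (V : set E) (h : E -> F) p : smooth_on V h -> V p.1 ->
  exists2 D, fderiv (tangent_map h) p D & forall z w,
    D (z, w) = (Diff h p.1 z, Diff (Diff h) p.1 z p.2 + Diff h p.1 w).
Proof.
move=> sh Vp; have f1 := fderiv_clin (fstl E E) p.
have hf := fderiv_comp f1 (smooth_fderiv sh Vp).
have Dhf := fderiv_comp f1 (smooth_fderiv (smooth_Diff sh) Vp).
have := fderiv_pair hf (fderiv_bil (idl _) Dhf (fderiv_clin (sndl E E) p)).
set D := (_ + _) => DP; exists D => // z w.
rewrite /D clin_addE !complE clin_addE !complE.
by congr pair; rewrite /= ?addr0 ?add0r// addrC.
Qed.

Lemma fderiv_time_map E F (h : E -> F) (p : (R^o * E)%type) A :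
  fderiv h p.2 A ->
  exists2 D, fderiv (time_map h) p D & forall s z, D (s, z) = (s, A z).
Proof.
move=> hA; have := fderiv_pair (fderiv_clin (fstl R^o E) p)
  (fderiv_comp (fderiv_clin (sndl R^o E) p) hA).
set D := (_ + _) => DP; exists D => // s z.
by congr pair; rewrite /= ?addr0 ?add0r.
Qed.

End prolongation.

Section local_lagrangian.
(* Keeps unification from unfolding differentials that are to be treated as
   unknown linear maps. *)
Local Opaque Diff.
Context {R : realType} {E : normedModType R}.
Local Notation V := (R^o * (E * E))%type.

(** The directions in which [D2] and [D3] differentiate *)
Definition in2 : 'L(E, V) := compl (inrl R^o _) (inll E E).
Definition in3 : 'L(E, V) := compl (inrl R^o _) (inrl E E).

Lemma D2E (F : normedModType R) (f : V -> F) p :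
  differentiable f p -> D2 f p = compl (Diff f p) in2.
Proof.
case: p => t [x y] df.
have slice : fderiv (fun x' : E => (t, (x', y))) x in2.
  have := fderivD (fderiv_cst (t, (0, y)) x) (fderiv_clin in2 x).
  rewrite add0r; apply: fderiv_near; apply: nearW => x' /=.
  by congr (_, (_, _)) => /=; rewrite ?addr0 ?add0r.
by have [_] := fderiv_comp slice (fderiv_Diff df).
Qed.

Lemma D3E (F : normedModType R) (f : V -> F) p :
  differentiable f p -> D3 f p = compl (Diff f p) in3.
Proof.
case: p => t [x y] df.
have slice : fderiv (fun y' : E => (t, (x, y'))) y in3.
  have := fderivD (fderiv_cst (t, (x, 0)) y) (fderiv_clin in3 y).
  rewrite add0r; apply: fderiv_near; apply: nearW => y' /=.
  by congr (_, (_, _)) => /=; rewrite ?addr0 ?add0r.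
by have [_] := fderiv_comp slice (fderiv_Diff df).
Qed.

Lemma smooth_D2 (F : normedModType R) (O : set V) (f : V -> F) :
  smooth_on O f -> smooth_on O (D2 f).
Proof.
move=> sf; apply: (smooth_ext (f := fun p => precomp E V F in2 (Diff f p))).
  by move=> p Op; rewrite D2E//; exact: smooth_differentiable sf Op.
exact: smooth_post (smooth_Diff sf).
Qed.

Lemma smooth_D3 (F : normedModType R) (O : set V) (f : V -> F) :
  smooth_on O f -> smooth_on O (D3 f).
Proof.
move=> sf; apply: (smooth_ext (f := fun p => precomp E V F in3 (Diff f p))).
  by move=> p Op; rewrite D3E//; exact: smooth_differentiable sf Op.
exact: smooth_post (smooth_Diff sf).
Qed.

Lemma Diff_split_acc (F : normedModType R) (f : V -> F) p s z w :
  differentiable f p ->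
  Diff f p (s, (z, w)) = Diff f p (s, (z, 0)) + D3 f p w.
Proof.
move=> df; have -> : (s, (z, w)) = (s, (z, 0)) + in3 w.
  by congr (_, (_, _)) => /=; rewrite ?addr0 ?add0r.
by rewrite (clinD _ (s, _)) (D3E df).
Qed.

Lemma Diff_split (F : normedModType R) (f : V -> F) p s z w :
  differentiable f p ->
  Diff f p (s, (z, w)) = s *: Diff f p (1, (0, 0)) + D2 f p z + D3 f p w.
Proof.
move=> df; rewrite Diff_split_acc//; congr (_ + _).
have -> : (s, (z, 0)) = s *: (1, (0, 0)) + in2 z.
  congr (_, (_, _)) => /=; rewrite ?scaler0 ?addr0 ?add0r//.
  by rewrite [RHS]mulr1.
by rewrite (clinD _ (_ *: _)) clinZ (D2E df).
Qed.
Local Opaque compl D2 D3.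

(** Along a curve x with value, velocity and acceleration (p.2.1, p.2.2, a) at
    time p.1, the left-hand side is the derivative of D3 l (t, x, x'). *)
Definition el_eq (l : V -> R^o) (p : V) (a : E) : Prop :=
  Diff (D3 l) p (1, (p.2.2, a)) = D2 l p.

Definition toplinear_inv (F G : normedModType R) (A : 'L(F, G)) : 'L(G, F) :=
  get [set B : 'L(G, F) | (forall x, B (A x) = x) /\ (forall y, A (B y) = y)].

Lemma toplinear_invP (F G : normedModType R) (A : 'L(F, G)) :
  toplinear_iso A -> (forall x, toplinear_inv A (A x) = x) /\
                     (forall y, A (toplinear_inv A y) = y).
Proof. by move=> isoA; exact: (getPex isoA). Qed.

Section fixed_lagrangian.
Variables (l : V -> R^o) (O : set V).
Hypothesis sl : smooth_on O l.

(** The terms in the last component of [v] cancel between omega and dE /\ dt, and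
    the component along dt is determined by the others: it is the defect of the
    Euler-Lagrange equation, evaluated at the velocity. *)
Lemma Omega_formE p a v : O p ->
  let W := (1, (p.2.2, a)) in
  let defect := Diff (D3 l) p W - D2 l p in
  Omega_form l p W v = v.1 * defect p.2.2 - defect v.2.1.
Proof.
case: v => s [z w] Op W defect.
have dl : differentiable l p := smooth_differentiable sl Op.
have dD3 := smooth_fderiv (smooth_D3 sl) Op.
have dth u' u : 'd (fun q => theta_form l q u) p u' = Diff (D3 l) p u' u.2.1.
  have th := fderiv_comp dD3 (fderiv_clin (evalc E R^o u.2.1) (D3 l p)).
  have [dth th'] : fderiv (fun q => theta_form l q u) p _ := th.
  by rewrite -DiffE// th'.
have dE u : 'd (energy l) p u =
    D3 l p u.2.2 + Diff (D3 l) p u p.2.2 - Diff l p u.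
  have e := fderivB (fderiv_bil (idl _) dD3
    (fderiv_clin (compl (sndl E E) (sndl R^o _)) p)) (fderiv_Diff dl).
  have [dE' E'] : fderiv (energy l) p _ := e.
  by rewrite -DiffE// E'.
have -> : Omega_form l p W (s, (z, w)) =
  - ('d (fun q => theta_form l q (s, (z, w))) p W
     - 'd (fun q => theta_form l q W) p (s, (z, w)))
  + ('d (energy l) p W * s - 'd (energy l) p (s, (z, w)) * 1) by [].
transitivity (- (Diff (D3 l) p W z - Diff (D3 l) p (s, (z, w)) p.2.2)
  + ((D3 l p a + Diff (D3 l) p W p.2.2 - Diff l p W) * s
     - (D3 l p w + Diff (D3 l) p (s, (z, w)) p.2.2 - Diff l p (s, (z, w))) * 1)).
  congr (- (_ - _) + (_ * _ - _ * _)); [exact: dth|exact: dth|exact: dE|exact: dE].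
rewrite (Diff_split s z w dl) (Diff_split 1 p.2.2 a dl).
have arith (PWz Pvy PWy D3a D3w D1 D2y D2z r : R) :
    - (PWz - Pvy) + ((D3a + PWy - (1 * D1 + D2y + D3a)) * r
                     - (D3w + Pvy - (r * D1 + D2z + D3w)) * 1) =
    r * (PWy - D2y) - (PWz - D2z) by ring.
exact: arith.
Qed.

Lemma Omega_form_eq0 p a : O p ->
  (forall v, Omega_form l p (1, (p.2.2, a)) v = 0) <-> el_eq l p a.
Proof.
move=> Op; split=> [h|h v]; last first.
  by rewrite Omega_formE// h subrr mulr0 subr0.
apply/subr0_eq/clinP => z.
have := h (0, (z, 0)); rewrite Omega_formE// mul0r sub0r => /eqP.
by rewrite oppr_eq0 => /eqP.
Qed.

Hypothesis reg : forall p, O p -> toplinear_iso (D3 (D3 l) p).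

(** The Euler-Lagrange equation is affine in the acceleration, with linear part
    [D3 (D3 l) p] and constant part its value for the acceleration 0. *)
Definition el_acc (p : V) : E :=
  toplinear_inv (D3 (D3 l) p) (D2 l p - Diff (D3 l) p (1, (p.2.2, 0))).

Lemma el_eqP p a : O p -> el_eq l p a <-> a = el_acc p.
Proof.
move=> Op; have [BA AB] := toplinear_invP (reg Op).
have dD3 := smooth_differentiable (smooth_D3 sl) Op.
have split_a : Diff (D3 l) p (1, (p.2.2, a)) =
    Diff (D3 l) p (1, (p.2.2, 0)) + D3 (D3 l) p a.
  exact: Diff_split_acc.
rewrite /el_eq split_a /el_acc; split=> [<-|->].
  by rewrite [X in toplinear_inv _ X]addrC addKr BA.
by rewrite AB addrC subrK.
Qed.

Lemma smooth_el_acc : smooth_on O el_acc.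
Proof.
have oO := smooth_on_open sl.
have s3 := smooth_D3 sl; have s33 := smooth_D3 s3.
apply: (smooth_bil (idl _) (f := fun p => toplinear_inv (D3 (D3 l) p))
   (g := fun p => D2 l p - Diff (D3 l) p (1, (p.2.2, 0)))).
  by apply: (smooth_inverse oO _ _ s33) => p Op; have [] := toplinear_invP (reg Op).
apply: smoothD; first exact: smooth_D2.
apply: smoothN.
apply: (smooth_bil (idl _) (f := Diff (D3 l)) (g := fun p : V => (1, (p.2.2, 0)))).
  exact: smooth_Diff.
apply: smooth_pair; first exact: smooth_cst.
exact: (smooth_clin (compl (compl (inll E E) (sndl E E)) (sndl R^o _)) oO).
Qed.

End fixed_lagrangian.

Local Transparent compl.

(** The second derivatives of the change of charts [h] that appear on the two
    sides of the equation cancel because they are symmetric. *)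
Lemma el_eq_change (l l' : V -> R^o) (O O' : set V) (U : set E) (h : E -> E) p a :
  smooth_on O l -> smooth_on O' l' -> smooth_on U h ->
  (forall q, O q -> U q.2.1) ->
  (forall q, O q -> O' (time_map (tangent_map h) q)) ->
  (forall q, O q -> l q = l' (time_map (tangent_map h) q)) ->
  O p -> (forall w, exists z, Diff h p.2.1 z = w) ->
  el_eq l p a ->
  el_eq l' (time_map (tangent_map h) p)
    (Diff (Diff h) p.2.1 p.2.2 p.2.2 + Diff h p.2.1 a).
Proof.
move=> sl sl' sh OU OO' ll' Op surj.
pose tau := time_map (tangent_map h).
have oO := smooth_on_open sl.
have dtau q : O q -> exists2 D, fderiv tau q D & forall s z w,
    D (s, (z, w)) = (s, (Diff h q.2.1 z,
                      Diff (Diff h) q.2.1 z q.2.2 + Diff h q.2.1 w)).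
  move=> Oq; have [D1 hD1 D1E] := fderiv_tangent_map sh (OU _ Oq).
  have [D hD DE] := fderiv_time_map hD1.
  by exists D => // s z w; rewrite DE D1E.
have Dl q D : O q -> fderiv tau q D -> Diff l q = compl (Diff l' (tau q)) D.
  move=> Oq tD; have dl' := smooth_fderiv sl' (OO' _ Oq).
  apply: fderiv_unique (smooth_fderiv sl Oq) _.
  apply: fderiv_near (fderiv_comp tD dl').
  by apply: filterS (open_nbhs_nbhs (conj oO Oq)) => q' /ll'.
have D3l q : O q ->
    D3 l q = postcomp E E R^o (D3 l' (tau q)) (Diff h q.2.1).
  move=> Oq; have [D tD DE] := dtau q Oq.
  rewrite D3E; last exact: smooth_differentiable sl Oq.
  rewrite (Dl _ _ Oq tD) D3E; last exact: smooth_differentiable sl' (OO' _ Oq).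
  have DE3 w : D (in3 w) = in3 (Diff h q.2.1 w).
    by rewrite [LHS]DE !clin0 clin_zeroE add0r.
  apply: clinP => w.
  have := congr1 (Diff l' (tau q)) (DE3 w).
  exact.
have [D tD DE] := dtau p Op.
have OD := OO' _ Op.
have dD3l' := smooth_fderiv (smooth_D3 sl') OD.
have dDh := smooth_fderiv (smooth_Diff sh) (OU _ Op).
have dpos := fderiv_clin (compl (fstl E E) (sndl R^o _)) p.
have near_D3l : \forall q \near p,
    postcomp E E R^o (D3 l' (tau q)) (Diff h q.2.1) = D3 l q.
  by apply: filterS (open_nbhs_nbhs (conj oO Op)) => q /D3l.
have [_ DD3l] := fderiv_near near_D3l
  (fderiv_bil (postcomp E E R^o) (fderiv_comp tD dD3l') (fderiv_comp dpos dDh)).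
have sym u v : Diff (Diff h) p.2.1 u v = Diff (Diff h) p.2.1 v u.
  apply: (second_derivative_sym (smooth_on_open sh) (OU _ Op) _ dDh).
  by move=> y; exact: smooth_differentiable.
move=> el; rewrite /el_eq DD3l in el.
apply: clinP => w; have [z <-] := surj w.
have dl' := smooth_differentiable sl' OD.
have DE2 : D (in2 z) = (0, (Diff h p.2.1 z, Diff (Diff h) p.2.1 z p.2.2)).
  by rewrite [LHS]DE (clin0 (Diff h _)) addr0.
rewrite (D2E (smooth_differentiable sl Op)) (Dl _ _ Op tD) in el.
(* the equation of l at z, in terms of l' *)
have elz : D3 l' (tau p) (Diff (Diff h) p.2.1 p.2.2 z)
    + Diff (D3 l') (tau p) (D (1, (p.2.2, a))) (Diff h p.2.1 z)
    = Diff l' (tau p) (D (in2 z)) := congr1 (fun A : 'L(E, R^o) => A z) el.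
rewrite DE2 DE (Diff_split _ _ _ dl') scale0r add0r sym addrC in elz.
exact: addIr elz.
Qed.

End local_lagrangian.

(** * Charts, curves and jets *)

Section charts.
Context {R : realType} {E : normedModType R} (A : atlas E).
Implicit Types (i j : atlas_index A) (m : A).

Definition charts_inj : Prop := forall i m m', dom i m -> dom i m' ->
  chart i m = chart i m' -> m = m'.

Definition trans i j : E -> E := local_expr i (chart j).

Definition overlap i j : set E := chart i @` (dom i `&` dom j).

Lemma overlap_chart i j m : dom i m -> dom j m -> overlap i j (chart i m).
Proof. by move=> im jm; exists m. Qed.

Lemma img_chart i m : dom i m -> img i (chart i m).
Proof. by move=> im; exists m. Qed.

Lemma local_exprE {W : pointedType} i (f : A -> W) m : charts_inj ->
  dom i m -> local_expr i f (chart i m) = f m.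
Proof.
move=> inj im; rewrite /local_expr.
have : [set w | exists2 m', dom i m' /\ chart i m' = chart i m & w = f m'] (f m).
  by exists m.
by move=> /(getI (x:=f m)) [m' [im' /(inj _ _ _ im' im) ->]].
Qed.

(** [m0] is a default value off the image of the chart. *)
Definition point_over i (m0 : A) (x : E) : A :=
  if pselect (img i x) is left ix then projT1 (cid2 ix) else m0.

Lemma point_overP i m0 x : img i x ->
  dom i (point_over i m0 x) /\ chart i (point_over i m0 x) = x.
Proof. by rewrite /point_over; case: pselect => // ix _; case: cid2. Qed.

End charts.

Section manifold_curves.
Context {R : realType} {E : normedModType R} (A : atlas E).
Hypothesis mA : is_manifold A.
Implicit Types (i j : atlas_index A) (m : A) (c : R -> A).

Lemma manifold_inj : charts_inj A.
Proof. by case: mA => _ inj _; exact: inj. Qed.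

Lemma manifold_cover m : exists i, dom i m.
Proof. by case: mA => cover _ _; exact: cover. Qed.

Lemma smooth_trans i j : smooth_on (overlap i j) (trans i j).
Proof. by case: mA => _ _ sm; exact: sm. Qed.

Lemma open_img i : open (img i).
Proof. by have := smooth_on_open (smooth_trans i i); rewrite /overlap setIid. Qed.

Lemma transE i j m : dom i m -> trans i j (chart i m) = chart j m.
Proof. exact: local_exprE manifold_inj. Qed.

Lemma Diff_transK i j m v : dom i m -> dom j m ->
  Diff (trans j i) (chart j m) (Diff (trans i j) (chart i m) v) = v.
Proof.
move=> im jm.
have dij := smooth_fderiv (smooth_trans i j) (overlap_chart im jm).
have dji := smooth_fderiv (smooth_trans j i) (overlap_chart jm im).
have trm := transE j im; rewrite -trm in dji.
have : fderiv (fun x => trans j i (trans i j x)) (chart i m) (idl E).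
  apply: fderiv_near (fderiv_clin (idl E) _).
  apply: filterS (open_nbhs_nbhs (conj (smooth_on_open (smooth_trans i j))
    (overlap_chart im jm))) => _ [m' [im' jm'] <-].
  by rewrite transE// transE.
move=> /(fderiv_unique (fderiv_comp dij dji)) /(congr1 (fun B : 'L(E, E) => B v)).
by rewrite trm.
Qed.

Lemma smooth_preimage_open {F : normedModType R} (U : set F) (f : F -> E) O :
  smooth_on U f -> open O -> open (U `&` f @^-1` O).
Proof.
move=> sf oO; rewrite openE => x [Ux Ofx]; apply: filterI.
  exact: open_nbhs_nbhs (conj (smooth_on_open sf) Ux).
have cf := differentiable_continuous (smooth_differentiable sf Ux).
exact: cf (open_nbhs_nbhs (conj oO Ofx)).
Qed.

(** A curve known to be smooth in the chart j stays in the domain of i for a short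
    time because the overlap of i and j is open in the chart j. *)
Lemma curve_in_chart c t i : smooth_curve_at c t -> dom i (c t) ->
  exists U : set R^o, [/\ U t, forall s, U s -> dom i (c s)
                        & smooth_on U (fun s : R^o => chart i (c s))].
Proof.
move=> [j [U [Ut Uj sU]]] it.
have str := smooth_trans j i.
pose U' := U `&` (fun s : R^o => chart j (c s)) @^-1` overlap j i.
have oU' : open U' := smooth_preimage_open sU (smooth_on_open str).
have U'i s : U' s -> dom i (c s).
  move=> [Us [m [jm im] jE]].
  by rewrite -(manifold_inj jm (Uj s Us) jE).
exists U'; split=> //; first by split=> //; exact: overlap_chart (Uj t Ut) it.
apply: (smooth_ext (f := fun s : R^o => trans j i (chart j (c s)))).
  by move=> s [Us _]; rewrite transE//; exact: Uj.
apply: (smooth_comp (V := overlap j i)) => //; first by move=> s [].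
by apply: smooth_sub sU => // s [].
Qed.

Lemma curve_velocity_change c t i j : smooth_curve_at c t ->
  dom i (c t) -> dom j (c t) ->
  (fun s : R => chart j (c s))^`()%classic t =
    Diff (trans i j) (chart i (c t)) ((fun s : R => chart i (c s))^`()%classic t).
Proof.
move=> sc it jt; have [U [Ut Ui sU]] := curve_in_chart sc it.
have ov := overlap_chart it jt.
rewrite -(derive1_comp_smooth sU Ut (smooth_differentiable (smooth_trans i j) ov)).
apply: derive1_near.
apply: filterS (open_nbhs_nbhs (conj (smooth_on_open sU) Ut)) => s Us.
by rewrite transE//; exact: Ui.
Qed.

Lemma curve_acceleration_change c t i j : smooth_curve_at c t ->
  dom i (c t) -> dom j (c t) ->
  let x := fun s : R => chart i (c s) in
  (fun s : R => chart j (c s))^`(2)%classic t =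
    Diff (Diff (trans i j)) (x t) (x^`()%classic t) (x^`()%classic t)
    + Diff (trans i j) (x t) (x^`(2)%classic t).
Proof.
move=> sc it jt x; have [U [Ut Ui sU]] := curve_in_chart sc it.
have [V [Vt Vj sV]] := curve_in_chart sc jt.
have oW : open (U `&` V) by apply: openI; [case: sU|case: sV].
have sW : smooth_on (U `&` V) (x : R^o -> E) by apply: smooth_sub sU => // s [].
have Wov s : (U `&` V) s -> overlap i j (x s).
  by move=> [Us Vs]; apply: overlap_chart; [exact: Ui|exact: Vj].
rewrite -(derive2_comp_smooth sW (smooth_trans i j) Wov (conj Ut Vt)).
rewrite !derive1nS !derive1n0; apply: derive1_near.
apply: filterS (open_nbhs_nbhs (conj oW (conj Ut Vt))) => s Ws.
apply: derive1_near.
apply: filterS (open_nbhs_nbhs (conj oW Ws)) => r [Ur _].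
by rewrite transE//; exact: Ui.
Qed.

Lemma parabola_curve i m y a : dom i m ->
  exists2 c, smooth_curve_at c 0 &
    [/\ c 0 = m, (fun s : R => chart i (c s))^`()%classic 0 = y
      & (fun s : R => chart i (c s))^`(2)%classic 0 = a].
Proof.
move=> im; pose p : R^o -> E := parabola (chart i m) y a.
pose c (s : R) := point_over i m (p s).
pose U := setT `&` p @^-1` img i.
have oU : open U by apply: smooth_preimage_open (open_img i); exact: parabola_smooth.
have p0 : p 0 = chart i m by exact: parabola0.
have U0 : U 0 by split=> //; rewrite /preimage /= p0; exact: img_chart.
have cU s : U s -> dom i (c s) /\ chart i (c s) = p s.
  by move=> [_ ips]; exact: point_overP.
have nearU s : U s -> \forall r \near (s : R^o), chart i (c r) = p r.
  by move=> Us; apply: filterS (open_nbhs_nbhs (conj oU Us)) => r /cU[].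
exists c.
  exists i, U; split=> //; first by move=> s /cU[].
  apply: (smooth_ext (f := p)); first by move=> s /cU[].
  by apply: smooth_sub (parabola_smooth _ _ _) => // s [].
split.
- by have [ic cE] := cU _ U0; apply: (manifold_inj ic im); rewrite cE.
- by rewrite (derive1_near (nearU _ U0)) parabola_derive1 scale0r addr0.
- rewrite derive1nS derive1n1 (@derive1_near _ _ _ (p : R -> E)^`()%classic).
    exact: parabola_derive2.
  apply: filterS (open_nbhs_nbhs (conj oU U0)) => s Us.
  exact: derive1_near (nearU _ Us).
Qed.

End manifold_curves.

Section jets.
Context {R : realType} {E : normedModType R} (A : atlas E).
Hypothesis mA : is_manifold A.
Implicit Types (i j : atlas_index A) (m : A) (c : R -> A).

(** Derivatives of order 1 and 2 in one chart determine those in another by the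
    transformation formulas, so that the chart in the definition of
    equivalence does not matter. *)
Lemma jet_equiv_chart k c c' i n : (k <= 2)%N ->
  smooth_curve_at c 0 -> smooth_curve_at c' 0 -> jet_equiv k c c' ->
  dom i (c 0) -> (0 < n <= k)%N ->
  (fun s : R => chart i (c s))^`(n)%classic 0 =
  (fun s : R => chart i (c' s))^`(n)%classic 0.
Proof.
move=> k2 sc sc' [cc' [j jc D]] ic /andP[n0 nk].
have ic' := ic; have jc' := jc; rewrite cc' in ic' jc'.
have D1 : (fun s : R => chart j (c s))^`()%classic 0 =
          (fun s : R => chart j (c' s))^`()%classic 0.
  by apply: (D 1%N); rewrite (leq_trans n0 nk).
have n12 : n = 1%N \/ n = 2%N.
  by case: n n0 nk (leq_trans nk k2) => [|[|[|n]]]; auto.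
clear n0; case: n12 => nE; rewrite {n}nE in nk *.
  rewrite !derive1n1 (curve_velocity_change mA sc jc ic).
  by rewrite (curve_velocity_change mA sc' jc' ic') D1 cc'.
rewrite (curve_acceleration_change mA sc jc ic).
by rewrite (curve_acceleration_change mA sc' jc' ic') D1 cc' (D 2%N).
Qed.

Lemma jet_equivP k c c' i : (k <= 2)%N ->
  smooth_curve_at c 0 -> smooth_curve_at c' 0 -> dom i (c 0) ->
  jet_equiv k c c' <-> c 0 = c' 0 /\ forall n, (0 < n <= k)%N ->
    (fun s : R => chart i (c s))^`(n)%classic 0 =
    (fun s : R => chart i (c' s))^`(n)%classic 0.
Proof.
move=> k2 sc sc' ic; split=> [cc'|[cc' D]]; last by split=> //; exists i.
by split=> [|n]; [case: cc'|exact: jet_equiv_chart].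
Qed.

Lemma jet_rep_smooth k (q : jet A k) : smooth_curve_at (jet_rep q) 0.
Proof. by rewrite /jet_rep; case: cid2. Qed.

Lemma jet_mem k (q : jet A k) c :
  proj1_sig q c <-> smooth_curve_at c 0 /\ jet_equiv k (jet_rep q) c.
Proof. by rewrite /jet_rep; case: cid2 => r /= sr ->. Qed.

Lemma jet_chart k (q : jet A k) c i n : (k <= 2)%N ->
  proj1_sig q c -> dom i (c 0) -> (0 < n <= k)%N ->
  (fun s : R => chart i (jet_rep q s))^`(n)%classic 0 =
  (fun s : R => chart i (c s))^`(n)%classic 0.
Proof.
move=> k2 /jet_mem[sc qc] ic nk; apply: (jet_equiv_chart k2) => //.
  exact: jet_rep_smooth.
by case: qc => ->.
Qed.

Lemma jet_base_mem k (q : jet A k) c : proj1_sig q c -> jet_base q = c 0.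
Proof. by move=> /jet_mem[_ []]. Qed.

Lemma jet_class k c : smooth_curve_at c 0 -> exists q : jet A k, proj1_sig q c.
Proof.
move=> sc; pose S := [set d | smooth_curve_at d 0 /\ jet_equiv k c d].
have hS : exists2 c', smooth_curve_at c' 0 &
    S = [set d | smooth_curve_at d 0 /\ jet_equiv k c' d] by exists c.
exists (exist _ S hS); split=> //; split=> //.
by have [i ic] := manifold_cover mA (c 0); exists i.
Qed.

Lemma jet_eq k (q q' : jet A k) i : (k <= 2)%N -> dom i (jet_base q) ->
  jet_base q = jet_base q' ->
  (forall n, (0 < n <= k)%N ->
    (fun s : R => chart i (jet_rep q s))^`(n)%classic 0 =
    (fun s : R => chart i (jet_rep q' s))^`(n)%classic 0) -> q = q'.
Proof.
move=> k2 iq bqq' D.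
have iq' : dom i (jet_base q') by rewrite -bqq'.
have sr := jet_rep_smooth q; have sr' := jet_rep_smooth q'.
have Sqq' : proj1_sig q = proj1_sig q'.
  apply/seteqP; split=> c /jet_mem[sc].
    move=> /(jet_equivP k2 sr sc iq)[b Dc]; apply/jet_mem; split=> //.
    apply/(jet_equivP k2 sr' sc iq'); rewrite -b; split=> // n nk.
    by rewrite -D// Dc.
  move=> /(jet_equivP k2 sr' sc iq')[b Dc]; apply/jet_mem; split=> //.
  apply/(jet_equivP k2 sr sc iq); rewrite -b; split=> // n nk.
  by rewrite D// Dc.
case: q q' Sqq' {iq bqq' D iq' sr sr'} => S hS [S' hS'] /= SS'.
by rewrite -SS' in hS' *; congr exist; exact: Prop_irrelevance.
Qed.

End jets.

(** * The tangent manifold and the product with the time axis *)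

Section constructions.
Context {R : realType} {E : normedModType R} (A : atlas E).
Hypothesis mA : is_manifold A.
Implicit Types (i j : atlas_index A) (m : A) (c : R -> A).

Definition velocity (k : nat) i (q : jet A k) : E :=
  (fun s : R => chart i (jet_rep q s))^`()%classic 0.

Definition acceleration (k : nat) i (q : jet A k) : E :=
  (fun s : R => chart i (jet_rep q s))^`(2)%classic 0.

Lemma velocity_mem k i (q : jet A k) c : (0 < k <= 2)%N -> proj1_sig q c ->
  dom i (c 0) -> velocity i q = (fun s : R => chart i (c s))^`()%classic 0.
Proof. by move=> /andP[k0 k2] qc ic; exact: (jet_chart mA (n := 1) k2 qc ic). Qed.

Lemma acceleration_mem i (q : jet A 2) c : proj1_sig q c ->
  dom i (c 0) -> acceleration i q = (fun s : R => chart i (c s))^`(2)%classic 0.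
Proof. by move=> qc ic; exact: (jet_chart mA (n := 2) _ qc ic). Qed.

Lemma jet1_eq i (q q' : jet A 1) : dom i (jet_base q) ->
  jet_base q = jet_base q' -> velocity i q = velocity i q' -> q = q'.
Proof.
move=> iq qq' v; apply: (jet_eq mA (leqnSn 1) iq qq') => n.
by rewrite andbC -eqn_leq => /eqP ->.
Qed.

Lemma jet2_eq i (q q' : jet A 2) : dom i (jet_base q) ->
  jet_base q = jet_base q' -> velocity i q = velocity i q' ->
  acceleration i q = acceleration i q' -> q = q'.
Proof.
move=> iq qq' v a; apply: (jet_eq mA (leqnn 2) iq qq') => n nk.
have [->|->] : n = 1%N \/ n = 2%N by case: n nk => [|[|[|n]]]; auto.
  exact: v.
exact: a.
Qed.

Lemma velocity_change k i j (q : jet A k) :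
  dom i (jet_base q) -> dom j (jet_base q) ->
  velocity j q = Diff (trans i j) (chart i (jet_base q)) (velocity i q).
Proof. exact: curve_velocity_change (jet_rep_smooth q). Qed.

Lemma acceleration_change k i j (q : jet A k) :
  dom i (jet_base q) -> dom j (jet_base q) ->
  acceleration j q =
    Diff (Diff (trans i j)) (chart i (jet_base q)) (velocity i q) (velocity i q)
    + Diff (trans i j) (chart i (jet_base q)) (acceleration i q).
Proof. exact: curve_acceleration_change (jet_rep_smooth q). Qed.

Lemma jet1_exists i m y : dom i m ->
  exists q : jet A 1, jet_base q = m /\ velocity i q = y.
Proof.
move=> im; have [c sc [c0 c1 _]] := parabola_curve mA y 0 im.
have [q qc] := jet_class mA 1 sc; exists q.
by rewrite (jet_base_mem qc) (velocity_mem (i := i) _ qc) ?c0.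
Qed.

Lemma jet2_exists i m y a : dom i m ->
  exists q : jet A 2,
    [/\ jet_base q = m, velocity i q = y & acceleration i q = a].
Proof.
move=> im; have [c sc [c0 c1 c2]] := parabola_curve mA y a im.
have [q qc] := jet_class mA 2 sc; exists q.
by rewrite (jet_base_mem qc) (velocity_mem (i := i) _ qc) ?(acceleration_mem qc) ?c0.
Qed.

Lemma tangent_chartE i (q : tangent A) :
  @chart _ _ (tangent A) i q = (chart i (jet_base q), velocity i q).
Proof. by []. Qed.

Lemma tangent_charts_inj : charts_inj (tangent A).
Proof.
move=> i q q' iq iq' /= [b v]; apply: (jet1_eq iq) => //.
exact: (manifold_inj mA) b.
Qed.

(** Every vector is the velocity of a curve, which makes the images of the charts
    of the tangent manifold full products. *)
Lemma tangent_overlap i j :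
  @overlap _ _ (tangent A) i j = [set p | overlap i j p.1].
Proof.
apply/seteqP; split=> [_ [q [iq jq] <-]|[x y] [m [im jm] /= <-]].
  exact: overlap_chart.
have [q [qm qy]] := jet1_exists y im.
by exists q; [rewrite /= qm|rewrite tangent_chartE qm qy].
Qed.

Lemma tangent_trans i j p : overlap i j p.1 ->
  @trans _ _ (tangent A) i j p = tangent_map (trans i j) p.
Proof.
move=> ijp; have : @overlap _ _ (tangent A) i j p by rewrite tangent_overlap.
move=> [q [iq jq] <-]; rewrite /trans (local_exprE _ tangent_charts_inj iq).
by rewrite !tangent_chartE (velocity_change iq jq) -(transE mA j iq).
Qed.

Lemma tangent_manifold : is_manifold (tangent A).
Proof.
split=> [q|i q q'|i j].
- by have [i iq] := manifold_cover mA (jet_base q); exists i.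
- exact: tangent_charts_inj.
- rewrite -/(overlap _ _) tangent_overlap.
  apply: (smooth_ext (f := tangent_map (@trans R E A i j))).
    by move=> p ijp; rewrite -tangent_trans.
  exact/smooth_tangent_map/(smooth_trans mA).
Qed.

Lemma time_charts_inj : charts_inj (time A).
Proof.
move=> i [t m] [t' m'] im im' [-> /= b]; congr pair.
exact: (manifold_inj mA im im' b).
Qed.

Lemma time_overlap i j :
  @overlap _ _ (time A) i j = [set p | overlap i j p.2].
Proof.
apply/seteqP; split=> [_ [[t m] [im jm] <-]|[t x] [m [im jm] /= <-]].
  exact: overlap_chart.
by exists (t, m).
Qed.

Lemma time_trans i j p : overlap i j p.2 ->
  @trans _ _ (time A) i j p = time_map (trans i j) p.
Proof.
move=> ijp; have : @overlap _ _ (time A) i j p by rewrite time_overlap.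
move=> [[t m] [im jm] <-]; rewrite /trans (local_exprE _ time_charts_inj im).
by rewrite /time_map /= -(transE mA j im).
Qed.

Lemma time_manifold : is_manifold (time A).
Proof.
split=> [[t m]|i p p'|i j].
- by have [i im] := manifold_cover mA m; exists i.
- exact: time_charts_inj.
- rewrite -/(overlap _ _) time_overlap.
  apply: (smooth_ext (f := time_map (@trans R E A i j))).
    by move=> p ijp; rewrite -time_trans.
  exact/smooth_time_map/(smooth_trans mA).
Qed.

End constructions.

(** * The semispray of a regular Lagrangian *)

Section lagrangian_semispray.
Context {R : realType} {E : normedModType R} (M : atlas E).
Hypothesis mM : is_manifold M.
Local Notation N := (time (tangent M)).
Local Notation velN := (@velocity _ _ N 1).
Variable L : N -> R^o.
Hypothesis sL : smooth_fun L.
Hypothesis regL : regular L.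
Implicit Types i j : atlas_index M.

Let mN : is_manifold N := time_manifold (tangent_manifold mM).

(** A chart of R x TM is indexed by a chart of M. *)
Definition local_L i : R^o * (E * E) -> R^o := @local_expr _ _ N _ i L.

Definition spray_vector i (p : R^o * (E * E)) : R^o * (E * E) :=
  (1, (p.2.2, el_acc (local_L i) p)).

Lemma local_L_smooth i : smooth_on (@img _ _ N i) (local_L i).
Proof. exact: (sL i). Qed.

Lemma local_L_regular i p : @img _ _ N i p ->
  toplinear_iso (D3 (D3 (local_L i)) p).
Proof. exact: (regL (i := i)). Qed.

Lemma spray_vector_smooth i : smooth_on (@img _ _ N i) (spray_vector i).
Proof.
have sl := local_L_smooth i; have oO := smooth_on_open sl.
apply: smooth_pair; first exact: smooth_cst.
apply: smooth_pair; first exact: (smooth_clin (compl (sndl E E) (sndl R^o _)) oO).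
exact: (smooth_el_acc sl (local_L_regular (i := i))).
Qed.

Lemma Omega_spray_vector i p a : @img _ _ N i p ->
  (forall v, Omega_form (local_L i) p (1, (p.2.2, a)) v = 0) <->
  a = el_acc (local_L i) p.
Proof.
move=> ip; have sl := local_L_smooth i.
apply: iff_trans (Omega_form_eq0 sl a ip) _.
exact: (el_eqP sl (local_L_regular (i := i)) a ip).
Qed.

Lemma overlap_N i j :
  @overlap _ _ N i j = [set p | overlap i j p.2.1].
Proof. by rewrite time_overlap (tangent_overlap mM). Qed.

Lemma trans_N i j p : overlap i j p.2.1 ->
  @trans _ _ N i j p = time_map (tangent_map (trans i j)) p.
Proof.
move=> ijp; rewrite (time_trans (tangent_manifold mM)); last first.
  by rewrite (tangent_overlap mM).
by rewrite /time_map (tangent_trans mM).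
Qed.

(** The transported acceleration solves the Euler-Lagrange equation of the chart j
    by [el_eq_change]; the solution is unique. *)
Lemma el_acc_change i j (m : N) : @dom _ _ N i m -> @dom _ _ N j m ->
  let p := @chart _ _ N i m in
  el_acc (local_L j) (@chart _ _ N j m) =
    Diff (Diff (trans i j)) p.2.1 p.2.2 p.2.2
    + Diff (trans i j) p.2.1 (el_acc (local_L i) p).
Proof.
move=> im jm p.
have sli := local_L_smooth i; have slj := local_L_smooth j.
have ov : @overlap _ _ N i j p by exact: overlap_chart.
have strN := smooth_trans mN i j.
have chartj (m' : N) : @dom _ _ N i m' -> @dom _ _ N j m' ->
    time_map (tangent_map (trans i j)) (@chart _ _ N i m') = @chart _ _ N j m'.
  move=> im' jm'; rewrite -trans_N.
    exact: (transE mN).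
  exact: overlap_chart.
have sub : smooth_on (@overlap _ _ N i j) (local_L i).
  apply: smooth_sub sli; first exact: smooth_on_open strN.
  by move=> _ [m' [im' _] <-]; exact: img_chart.
have eli : el_eq (local_L i) p (el_acc (local_L i) p).
  by apply/(el_eqP sli (local_L_regular (i := i))) => //; exact: img_chart.
apply/esym/(el_eqP slj (local_L_regular (i := j))); first exact: img_chart.
rewrite -(chartj m im jm).
apply: (el_eq_change sub slj (smooth_trans mM i j)) => //.
- by move=> q; rewrite overlap_N.
- by move=> _ [m' [im' jm'] <-]; rewrite chartj//; exact: img_chart.
- move=> _ [m' [im' jm'] <-]; rewrite chartj// /local_L.
  by rewrite !(local_exprE _ (manifold_inj mN)).
- move=> w; exists (Diff (trans j i) (chart j (jet_base m.2)) w).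
  exact: (Diff_transK mM).
Qed.

(** The derivative of a change of charts of R x TM sends (1, y, a) to
    (1, Dh y, D^2 h (y, y) + Dh a), in accordance with [el_acc_change]. *)
Lemma spray_vector_change i j (m : N) : @dom _ _ N i m -> @dom _ _ N j m ->
  Diff (@trans _ _ N i j) (@chart _ _ N i m)
    (spray_vector i (@chart _ _ N i m)) = spray_vector j (@chart _ _ N j m).
Proof.
move=> im jm; have ovM : overlap i j (chart i (jet_base m.2)).
  exact: overlap_chart.
have strN := smooth_trans mN i j.
have ov := @overlap_chart _ _ N i j m im jm.
have [D1 hD1 D1E] := @fderiv_tangent_map _ _ _ _ _ (@chart _ _ N i m).2
  (smooth_trans mM i j) ovM.
have [D hD DE] := fderiv_time_map hD1.
have -> : Diff (@trans _ _ N i j) (@chart _ _ N i m) = D.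
  apply: fderiv_unique (smooth_fderiv strN ov) _.
  apply: fderiv_near hD.
  apply: filterS (open_nbhs_nbhs (conj (smooth_on_open strN) ov)) => q.
  by rewrite overlap_N => /trans_N.
rewrite /spray_vector DE D1E (el_acc_change im jm); congr (1, (_, _)).
exact/esym/(velocity_change mM im jm).
Qed.

(** The tangent vector is built in one chart and has the prescribed expression in
    all of them. *)
Lemma spray_exists (m : N) : exists q : tangent N, jet_base q = m /\
  forall i, @dom _ _ N i m -> velN i q = spray_vector i (@chart _ _ N i m).
Proof.
have [i im] := manifold_cover mN m.
have [q [qm qi]] := jet1_exists mN (spray_vector i (@chart _ _ N i m)) im.
exists q; split=> // j jm.
rewrite (velocity_change mN (i := i)) ?qm// qi.
exact: spray_vector_change.
Qed.

Lemma principal_partE (Z : N -> tangent N) i (m : N) : @dom _ _ N i m ->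
  principal_part Z i (@chart _ _ N i m) = velN i (Z m).
Proof. by move=> im; rewrite /principal_part (local_exprE _ (manifold_inj mN) im). Qed.

Section spray.
Variable Z : N -> tangent N.
Hypothesis Z_base : forall m, jet_base (Z m) = m.
Hypothesis Z_velocity : forall m i, @dom _ _ N i m ->
  velN i (Z m) = spray_vector i (@chart _ _ N i m).

Lemma principal_part_spray i p :
  @img _ _ N i p -> principal_part Z i p = spray_vector i p.
Proof. by move=> [m im <-]; rewrite principal_partE// Z_velocity. Qed.

Lemma spray_compE i p :
  @img _ _ N i p -> spray_comp Z i p = - el_acc (local_L i) p.
Proof. by move=> ip; rewrite /spray_comp principal_part_spray. Qed.

Lemma lagrangian_spray : lagrangian_semispray L Z.
Proof.
split; last first.
  move=> i p ip; rewrite principal_part_spray//; split=> //.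
  by apply/(Omega_spray_vector _ ip).
split; last by move=> i p ip; rewrite principal_part_spray.
split=> // i; apply: smooth_ext (spray_vector_smooth i) => p ip.
by rewrite principal_part_spray.
Qed.

(** A tangent vector is determined by its base point and its velocity in one
    chart, and the equation i_Z Omega = 0 determines the acceleration. *)
Lemma lagrangian_spray_unique Z' : lagrangian_semispray L Z' -> Z' = Z.
Proof.
move=> [[[Z'_base _] Z'_spray] Z'_Omega]; apply/funext => m.
have [i im] := manifold_cover mN m.
have ip := @img_chart _ _ N i m im.
have iZ' : @dom _ _ N i (jet_base (Z' m)) by rewrite Z'_base.
have bases : jet_base (Z' m) = jet_base (Z m) by rewrite Z'_base Z_base.
apply: (jet1_eq mN iZ' bases).
have [] := Z'_spray i _ ip; have [_] := Z'_Omega i _ ip.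
rewrite (Z_velocity im) principal_partE//.
case: (velN i (Z' m)) => t [y a] /= Om t1 yp; rewrite t1 yp in Om *.
by rewrite ((Omega_spray_vector a ip).1 Om).
Qed.

End spray.
End lagrangian_semispray.

(** * The bundle of 2-jets and its zero section *)

Section shifted_curves.
Context {R : realType}.

Lemma derive1n_shift {E : normedModType R} n (x : R -> E) (t : R) :
  (fun s => x (t + s))^`(n)%classic = (fun s => x^`(n)%classic (t + s)).
Proof.
elim: n => [//|n IH]; rewrite !derive1nS IH; apply/funext => r.
rewrite /derive1.
suff -> : (fun h : R => h^-1 *: (x^`(n)%classic (t + (h + r)) - x^`(n)%classic (t + r)))
  = (fun h : R => h^-1 *: (x^`(n)%classic (h + (t + r)) - x^`(n)%classic (t + r))) by [].
by apply/funext => h; rewrite addrCA.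
Qed.

Lemma smooth_curve_shift {E : normedModType R} (A : atlas E) (c : R -> A) t :
  smooth_curve_at c t -> smooth_curve_at (fun s => c (t + s)) 0.
Proof.
move=> [i [U [Ut Ui sU]]].
have oU' : open [set s : R^o | U (t + s)].
  apply: (@open_comp _ _ (fun s : R^o => t + s)); last exact: smooth_on_open sU.
  by move=> s _; apply: continuousD; [exact: cst_continuous|exact: cvg_id].
exists i, [set s : R^o | U (t + s)]; split=> /=; first by rewrite addr0.
  by move=> s; exact: Ui.
apply: (smooth_comp (V := U) (f := fun s : R^o => t + s)) sU => //.
by apply: smoothD; [exact: smooth_cst|exact: (smooth_clin (idl R^o) oU')].
Qed.

End shifted_curves.

Section jet_bundle.
Context {R : realType} {E : normedModType R} (M : atlas E).
Hypothesis mM : is_manifold M.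
Local Notation N := (time (tangent M)).
Variable L : N -> R^o.
Hypothesis sL : smooth_fun L.
Hypothesis regL : regular L.
Variable Z : N -> tangent N.
Hypothesis Z_velocity : forall m i, @dom _ _ N i m ->
  @velocity _ _ N 1 i (Z m) = spray_vector L i (@chart _ _ N i m).
Implicit Types i j : atlas_index M.

Definition jet_triv i (p : R * jet M 2) : (R^o * E) * (E * E) :=
  let q := p.2 in let x := chart i (jet_base q) in
  ((p.1, x),
   (velocity i q, acceleration i q + spray_comp Z i (p.1, (x, velocity i q)))).

Lemma img_N i (t : R) m y : dom i m -> @img _ _ N i (t, (chart i m, y)).
Proof.
move=> im; have [q [qm qy]] := jet1_exists mM y im.
by exists (t, q); rewrite /= ?qm// -qy.
Qed.

Lemma spray_comp_chart i (t : R) m y : dom i m ->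
  spray_comp Z i (t, (chart i m, y)) =
  - el_acc (local_L L i) (t, (chart i m, y)).
Proof. by move=> im; apply: (spray_compE mM Z_velocity); exact: img_N. Qed.

Lemma jet_triv_induced : induced_trivializations Z jet_triv.
Proof.
move=> i t q c qc ic x; rewrite /jet_triv /= (jet_base_mem qc).
by rewrite (velocity_mem (k := 2) mM isT qc ic) (acceleration_mem mM qc ic).
Qed.

(** Linearity in B gives the transition maps of the bundle the smoothness of the
    derivatives of the changes of charts. *)
Definition diagl : 'L('L(E, E), 'L((E * E)%type, (E * E)%type)).
Proof.
apply: (@mk_bil _ 'L(E, E) (E * E)%type (E * E)%type
  (fun B v => (B v.1, B v.2)) _ _ 1 ler01).
- by move=> B a v w; congr pair; exact: linearP.
- by move=> v a B B'.
- move=> B v; rewrite mul1r prod_normE ge_max.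
  rewrite !(le_trans (clin_norm_le _ _))// ler_wpM2l//.
    by rewrite [leRHS]prod_normE le_max lexx orbT.
  by rewrite [leRHS]prod_normE le_max lexx.
Defined.

Lemma diaglE B v : diagl B v = (B v.1, B v.2).
Proof. by []. Qed.

(** The second derivatives of the change of charts enter the acceleration of a
    2-jet and the spray coefficients alike, and cancel in the sum. *)
Lemma jet_triv_change i j p : dom i (jet_base p.2) -> dom j (jet_base p.2) ->
  (jet_triv j p).2 =
    diagl (Diff (trans i j) (chart i (jet_base p.2))) (jet_triv i p).2.
Proof.
case: p => t q; rewrite diaglE /jet_triv [(t, q).2]/= [(t, q).1]/= => iq jq.
have vel := velocity_change mM iq jq.
congr pair; first exact: vel.
rewrite !spray_comp_chart// clinB (acceleration_change mM iq jq).
(* the 1-jet underlying q, a point of TM *)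
have [q1 [q1b q1v]] := jet1_exists mM (velocity i q) iq.
have iq1 : @dom _ _ N i (t, q1) by rewrite /= q1b.
have jq1 : @dom _ _ N j (t, q1) by rewrite /= q1b.
have chart1 : @chart _ _ N i (t, q1) = (t, (chart i (jet_base q), velocity i q)).
  by rewrite -q1b -q1v.
have chart2 : @chart _ _ N j (t, q1) = (t, (chart j (jet_base q), velocity j q)).
  rewrite vel -q1b -q1v -(velocity_change mM) //.
have := el_acc_change mM sL regL iq1 jq1.
rewrite chart1 chart2 /= => ->.
by rewrite opprD addrACA subrr add0r.
Qed.

(** For a fixed velocity, passing from x'' to x'' + G is a translation of E. *)
Lemma jet_triv_bij i (t : R) m y w : dom i m ->
  exists! p, pi2 p = (t, m) /\ jet_triv i p = ((t, chart i m), (y, w)).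
Proof.
move=> im; have [q [qm qy qa]] :=
  jet2_exists mM y (w - spray_comp Z i (t, (chart i m, y))) im.
exists (t, q); split=> [|[t' q'] [[-> q'm] [_ q'y q'w]]].
  by rewrite /pi2 /jet_triv /= qm qy qa subrK.
have iq : dom i (jet_base q) by rewrite qm.
congr pair; apply: (jet2_eq mM iq); first by rewrite qm q'm.
  by rewrite qy q'y.
by rewrite qa -q'w q'y q'm addrK.
Qed.

Lemma jet_vector_bundle : vector_bundle (@pi2 R E M) jet_triv.
Proof.
split=> [//|i [t m] [y w] im|i j]; first exact: (jet_triv_bij (i := i)).
exists (fun p => diagl (Diff (@trans _ _ M i j) p.2)); split.
- rewrite -/(@overlap _ _ (time M) i j) time_overlap.
  apply: smooth_post.
  exact: (smooth_snd R^o (smooth_Diff (smooth_trans mM i j))).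
- move=> [t m] im jm.
  exists (diagl (Diff (@trans _ _ M j i) (@chart _ _ M j m))).
  by split=> -[y w]; rewrite !diaglE /= !(Diff_transK mM).
- by move=> p ip jp; exact: jet_triv_change.
Qed.

(** The 2-jet of c at time t is represented by the shifted curve s |-> c (t + s),
    which has at 0 the derivatives of c at t. *)
Lemma zero_section_curveP (J : set R^o) (c : R -> M) : smooth_curve J c ->
  zero_section_integral_curve jet_triv J c <->
  forall (t : R) i, J t -> dom i (c t) ->
    let x : R -> E := fun s => chart i (c s) in
    x^`(2)%classic t + spray_comp Z i (t, (x t, x^`()%classic t)) = 0.
Proof.
move=> sc; have [_ _ sct] := sc.
have accE (t : R) i (q : jet M 2) : dom i (c t) ->
    proj1_sig q (fun s => c (t + s)) ->
    (jet_triv i (t, q)).2.2 =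
      (fun s : R => chart i (c s))^`(2)%classic t + spray_comp Z i
        (t, (chart i (c t), (fun s : R => chart i (c s))^`()%classic t)).
  move=> ic qc; have ic0 : dom i (c (t + 0)) by rewrite addr0.
  rewrite (@jet_triv_induced i t q _ qc ic0).
  have e n : (fun s => chart i (c (t + s)))^`(n)%classic 0 =
      (fun s => chart i (c s))^`(n)%classic t.
    by rewrite (derive1n_shift n (fun s => chart i (c s))) addr0.
  have e1 : (fun s => chart i (c (t + s)))^`()%classic 0 =
    (fun s => chart i (c s))^`()%classic t := e 1%N.
  by rewrite -[LHS]/(_ + spray_comp Z i (t, (_, _))) (e 2%N) e1 addr0.
split=> [[_ h] t i Jt ic x|h].
  have [q qc] := jet_class mM 2 (smooth_curve_shift (sct t Jt)).
  by rewrite -(accE t i q)//; exact: h.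
by split=> // t i q Jt ic qc; rewrite accE//; exact: h.
Qed.

(** The derivative of D3 L (s, x, x') is D (D3 L) (1, x', x''), and x'' is the
    acceleration for which this equals D2 L. *)
Lemma zero_section_euler_lagrange (J : set R^o) (c : R -> M) :
  zero_section_integral_curve jet_triv J c -> euler_lagrange L J c.
Proof.
move=> hc; have sc := hc.1; have [_ _ sct] := sc.
move=> s i Js ic x l.
have [U [Us Ui sx]] := curve_in_chart mM (sct s Js) ic.
have eqn := (zero_section_curveP sc).1 hc s i Js ic.
rewrite /= spray_comp_chart// in eqn; move/subr0_eq: eqn => acc.
set p := (s, (x s, x^`()%classic s)).
have ip : @img _ _ N i p by exact: img_N.
have sl : smooth_on (@img _ _ N i) l := sL i.
have el : el_eq l p (x^`(2)%classic s).
  by apply/(el_eqP sl (local_L_regular regL (i := i)) _ ip).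
have lift := fderiv_curve_pair (fderiv_curve_id s)
  (fderiv_curve_pair (smooth_fderiv_curve sx Us)
                     (smooth_fderiv_curve (smooth_derive1 sx) Us)).
have curve := fderiv_comp lift (smooth_fderiv (smooth_D3 sl) ip).
set D := (compl _ _) in curve.
have D1 : D 1 = D2 l p.
  by rewrite -el /D complE [linel _ _]scale1r.
split; rewrite -D1; first exact: fderiv_is_derive curve.
exact: fderiv_is_derive
  (fderiv_comp curve (fderiv_clin (evalc E R^o (x^`()%classic s)) _)).
Qed.

End jet_bundle.

Theorem theorem3p5 (R : realType) (E : completeNormedModType R) (M : atlas E)
    (hM : is_manifold M) (L : time (tangent M) -> R^o)
    (hL : smooth_fun L) (hreg : regular L) :
  exists Z : time (tangent M) -> tangent (time (tangent M)),
    [/\ lagrangian_semispray L Z,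
        forall Z', lagrangian_semispray L Z' -> Z' = Z
      & exists Phi : atlas_index M -> R * jet M 2 -> (R^o * E) * (E * E),
          [/\ induced_trivializations Z Phi,
              vector_bundle (@pi2 R E M) Phi,
              forall (J : set R^o) (c : R -> M), smooth_curve J c ->
                (zero_section_integral_curve Phi J c <->
                 forall (t : R) (i : atlas_index M), J t -> dom i (c t) ->
                   let x : R -> E := fun s => chart i (c s) in
                   x^`(2)%classic t + spray_comp Z i (t, (x t, x^`()%classic t)) = 0)
            & forall (J : set R^o) (c : R -> M),
                zero_section_integral_curve Phi J c ->
                euler_lagrange L J c]].
Proof.
have [Z Z_spec] := choice (spray_exists hM hL hreg).
have Z_base m : jet_base (Z m) = m by have [] := Z_spec m.
have Z_velocity m i : @dom _ _ (time (tangent M)) i m ->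
    @velocity _ _ (time (tangent M)) 1 i (Z m) =
    spray_vector L i (@chart _ _ (time (tangent M)) i m).
  by have [_ v] := Z_spec m; exact: v.
exists Z; split.
- exact: (lagrangian_spray hM hL hreg Z_base Z_velocity).
- exact: (lagrangian_spray_unique hM hL hreg Z_base Z_velocity).
exists (jet_triv Z); split.
- exact: (jet_triv_induced hM).
- exact: (jet_vector_bundle hM hL hreg Z_velocity).
- exact: (zero_section_curveP hM).
- exact: (zero_section_euler_lagrange hM hL hreg Z_velocity).
Qed.
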